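(* Let $\mathfrak g$ be a simple finite-dimensional Lie algebra over $\mathbb C$ with dual Coxeter number $h^\vee$, and let $\mathcal A^k$ be a good vertex (super)algebra (with associated set $K\subseteq\mathbb C$), having a weight grading by $\mathbb Z_{\ge0}$ with finite-dimensional weight spaces and admitting an injective map $V^k(\mathfrak g)\to\mathcal A^k$. Let $k$ be a parameter value for which $\mathcal A^k$ is not simple, let $\mathcal I$ be the maximal proper ideal of $\mathcal A^k$ graded by conformal weight, $\mathcal A_k=\mathcal A^k/\mathcal I$, let $\mathcal J$ be the kernel of the map $V^k(\mathfrak g)\to\mathcal A_k$, and suppose that $\mathcal J$ is maximal, so that $V^k(\mathfrak g)/\mathcal J=L_k(\mathfrak g)$. Let $\mathcal C^k=\mathrm{Com}(V^k(\mathfrak g),\mathcal A^k)$, $\mathcal C_k=\mathrm{Com}(L_k(\mathfrak g),\mathcal A_k)$, and let $\pi_k:\mathcal C^k\to\mathcal C_k$ be the homomorphism induced by the quotient map $\mathcal A^k\to\mathcal A_k$. Suppose that $\sqrt k\notin K$, that $k+h^\vee$ is a positive real number, and that all zero modes of the currents of the Cartan subalgebra $\mathfrak h\subseteq\mathfrak g$ in $V^k(\mathfrak g)$ act semisimply on $\mathcal A^k$. Then $\pi_k:\mathcal C^k\to\mathcal C_k$ is surjective.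
   Context: $V^k(\mathfrak g)=V^k(\mathfrak g,B)$ is the universal affine vertex algebra at level $k$, with $B$ the standard normalized Killing form: freely generated by $X^\xi$, $\xi\in\mathfrak g$, with $X^\xi(z)X^\eta(w)\sim kB(\xi,\eta)(z-w)^{-2}+X^{[\xi,\eta]}(w)(z-w)^{-1}$; $L_k(\mathfrak g)$ is its simple graded quotient. $\mathrm{Com}(\mathcal U,\mathcal W)$ is the set of $w\in\mathcal W$ with $u\circ_nw=0$ for all $n\ge0$ and all $u$ in the image of $\mathcal U$ in $\mathcal W$ ($\circ_n$ the $n$-th product). ''Generic $k$'' means all $k\in\mathbb C$ outside an at most countable set. Deformable families. For an at most countable $K\subseteq\mathbb C$, $F_K$ is the $\mathbb C$-algebra of rational functions $p(\kappa)/q(\kappa)$ in a formal variable $\kappa$ with $\deg p\le\deg q$ and all roots of $q$ in $K$. A deformable family is a vertex algebra $\mathcal B$ over $F_K$ which is a free $F_K$-module, with weight grading $\mathcal B=\bigoplus_{m\ge0}\mathcal B[m]$, each $\mathcal B[m]$ free of finite rank, $\mathcal B[0]\cong F_K$, and $a\circ_n$ of weight $m-n-1$ for $a\in\mathcal B[m]$. Its limit $\mathcal B^\infty=\lim_{\kappa\to\infty}\mathcal B$ is the complex vertex algebra with basis $\{\alpha_i\}$ indexed by a homogeneous $F_K$-basis $\{a_i\}$ of $\mathcal B$ and products $\alpha_i\circ_n\alpha_j=\phi(a_i\circ_na_j)$, $\phi(\sum f_ia_i)=\sum(\lim_{\kappa\to\infty}f_i)\alpha_i$. Let $\mathcal V$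 be the deformable family over $F_{\{0\}}$ freely generated by $a^\xi$, $\xi\in\mathfrak g$, with $a^\xi(z)a^\eta(w)\sim B(\xi,\eta)(z-w)^{-2}+\kappa^{-1}a^{[\xi,\eta]}(w)(z-w)^{-1}$, so $\mathcal V/(\kappa-\sqrt k)\cong V^k(\mathfrak g)$ via $a^\xi\mapsto X^\xi/\sqrt k$ for $k\neq0$. Good. $\mathcal A^k$, with structure constants depending continuously on $k$ and a homomorphism $V^k(\mathfrak g)\to\mathcal A^k$, is good if: (1) there is a deformable family $\mathcal A$ over $F_K$ for some at most countable $K\subseteq\mathbb C$ containing $0$ with $\mathcal A^k=\mathcal A/(\kappa-\sqrt k)$, and a homomorphism $\mathcal V\to\mathcal A$ inducing $V^k(\mathfrak g)\to\mathcal A^k$ for each $k$ with $\sqrt k\notin K$; (2) for generic $k$, $\mathcal A^k$ has a Virasoro element $L^{\mathcal A}$ and a conformal weight grading $\mathcal A^k=\bigoplus_{d\in\mathbb N}\mathcal A^k[d]$ with $\dim\mathcal A^k[d]$ finite and independent of $k$; (3) for generic $k$, $\mathcal A^k$ decomposes into finite-dimensional $\mathfrak g$-modules, so the action of $\mathfrak g$ integrates to an action of a connected Lie group $G$ with Lie algebra $\mathfrak g$; (4) $\mathcal A^\infty\cong\mathcal H(d)\otimes\tilde{\mathcal A}$, $d=\dim\mathfrak g$, $\mathcal H(d)$ the rank $d$ Heisenberg vertex algebra, where $\tilde{\mathcal A}$ is a vertex subalgebra of $\mathcal A^\infty$ with a Virasoro element and $\mathbb N$-grading by conformal weight with finite-dimensional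 components, and the action of $G$ on $\mathcal A^\infty$ preserves $\tilde{\mathcal A}$; (5) any highest-weight $V^k(\mathfrak g)$-submodule of $\mathcal A^k$ has, for generic $k$, finite-dimensional components for the grading by generalized $L_0^{\mathfrak g}$-eigenspaces, $L^{\mathfrak g}$ being the Sugawara vector. *)

(* Defs.v *)
From HB Require Import structures.
From mathcomp Require Import all_boot all_order all_algebra.
From mathcomp Require Import complex.
From mathcomp Require Import boolp classical_sets functions cardinality reals.
From mathcomp Require Import topology normedtype sequences.

Set Implicit Arguments.
Unset Strict Implicit.
Unset Printing Implicit Defensive.

Import Order.TTheory GRing.Theory Num.Theory numFieldNormedType.Exports.
Local Open Scope classical_set_scope.
Local Open Scope ring_scope.

(* The complex numbers. Going through [numClosedFieldType] gives them their
   norm topology; in the order of [Cx R], [0 < z] says that z is a positive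
   real number. *)
Definition Cx (R : realType) : numClosedFieldType := R[i].

Section Modules.
Variables (S : comNzRingType) (V : lmodType S).

Definition submodule (M : set V) : Prop :=
  M 0 /\ forall (c : S) (x y : V), M x -> M y -> M (c *: x + y).

Definition is_basis (I : choiceType) (b : I -> V) : Prop :=
  (forall v, exists (s : seq I) (c : I -> S), v = \sum_(i <- s) c i *: b i) /\
  (forall (s : seq I) (c : I -> S), uniq s ->
     \sum_(i <- s) c i *: b i = 0 -> forall i, i \in s -> c i = 0).

(* Internal direct sum decomposition of V. *)
Definition direct_sum (I : eqType) (M : I -> set V) : Prop :=
  [/\ forall i, submodule (M i),
      forall v, exists (s : seq I) (c : I -> V),
        [/\ uniq s, forall i, M i (c i) & v = \sum_(i <- s) c i]
    & forall (s : seq I) (c : I -> V), uniq s -> (forall i, M i (c i)) ->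
        \sum_(i <- s) c i = 0 -> forall i, i \in s -> c i = 0].

(* M is the direct sum of its intersections with the pieces D i. *)
Definition graded_for (I : eqType) (D : I -> set V) (M : set V) : Prop :=
  forall (s : seq I) (c : I -> V), uniq s -> (forall i, D i (c i)) ->
    M (\sum_(i <- s) c i) -> forall i, i \in s -> M (c i).

(* For a submodule M: M is free of rank n. *)
Definition has_dim (M : set V) (n : nat) : Prop :=
  exists b : 'I_n -> V, (forall i, M (b i)) /\
    forall v, M v ->
      exists! c : {ffun 'I_n -> S}, v = \sum_(i < n) c i *: b i.

Definition fin_dim (M : set V) : Prop := exists n, has_dim M n.

Definition gen_eigenspace (T : V -> V) (a : S) : set V :=
  [set v | exists N, iter N (fun w => T w - a *: w) v = 0].

(* Over C: V is the sum of the eigenspaces of T. *)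
Definition semisimple_op (T : V -> V) : Prop :=
  forall v, exists (s : seq S) (c : S -> V),
    (forall a, T (c a) = a *: c a) /\ v = \sum_(a <- s) c a.

End Modules.

Definition semilinear (S S' : comNzRingType) (h : S -> S')
    (V : lmodType S) (V' : lmodType S') (f : V -> V') : Prop :=
  forall (c : S) (x y : V), f (c *: x + y) = h c *: f x + f y.

(* The binomial coefficient m(m-1)...(m-i+1)/i! for an integer m. *)
Definition binz (m : int) (i : nat) : int :=
  match m with
  | Posz n => ('C(n, i))%:Z
  | Negz n => (-1) ^+ i * ('C(n + i, i))%:Z
  end.

Definition int_graded (T : zmodType) (wt : nat -> set T) (d : int) : set T :=
  match d with Posz n => wt n | Negz _ => [set 0] end.

(* Vertex superalgebras over S with a weight grading by the natural numbers.
   The sums in the Borcherds identity range over all i >= 0 and have finitely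
   many nonzero terms: they are equal to their partial sums of large enough
   length. *)
Record vertexSuperalgebra (S : comNzRingType) := VertexSuperalgebra {
  vsort :> lmodType S;
  vac : vsort;
  nprod : int -> vsort -> vsort -> vsort;
  parity : bool -> set vsort;
  weight : nat -> set vsort;
  parity_sum : direct_sum parity;
  weight_sum : direct_sum weight;
  weight_parity : forall m, graded_for parity (weight m);
  vac_even : parity false vac;
  vac_weight : weight 0 vac;
  nprod_parity : forall n p q a b,
    parity p a -> parity q b -> parity (p (+) q) (nprod n a b);
  nprod_weight : forall n m m' a b,
    weight m a -> weight m' b ->
    int_graded weight (m%:Z + m'%:Z - n - 1) (nprod n a b);
  nprod_linear_l : forall n b, linear (fun a => nprod n a b);
  nprod_linear_r : forall n a, linear (nprod n a);
  nprod_trunc : forall a b, exists N : nat, forall n : nat,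
    (N <= n)%N -> nprod n a b = 0;
  vac_nprod : forall n a, nprod n vac a = if n == -1 then a else 0;
  nprod_vac : forall a, nprod (-1) a vac = a;
  nprod_vac_ge0 : forall (n : nat) a, nprod n a vac = 0;
  borcherds : forall (l m n : int) (p q : bool) a b c,
    parity p a -> parity q b ->
    exists N0 : nat, forall N : nat, (N0 <= N)%N ->
      \sum_(i < N)
        nprod (m + l - i%:Z) (nprod (n + i%:Z) a b) c *~ binz m i =
      \sum_(i < N)
        (nprod (m + n - i%:Z) a (nprod (l + i%:Z) b c)
         - (-1) ^+ (`|n| + (p && q))%N *:
             nprod (n + l - i%:Z) b (nprod (m + i%:Z) a c))
        *~ ((-1) ^+ i * binz n i)
}.

Notation "a \circ_ n b" := (nprod n a b)
  (at level 40, n at level 2, format "a  \circ_ n  b") : ring_scope.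

Section VertexSuperalgebras.
Variables (S : comNzRingType).
Implicit Types V W : vertexSuperalgebra S.

Definition translation V (a : V) : V := a \circ_(- 2) (vac V).

(* Two-sided ideals of the superalgebra, hence stable under taking even and
   odd components. *)
Definition is_ideal V (I : set V) : Prop :=
  [/\ submodule I, graded_for (@parity S V) I
    & forall n a b, I a -> I (a \circ_n b) /\ I (b \circ_n a)].

Definition is_simple V : Prop :=
  ~ [set: V] `<=` [set 0] /\
  forall I : set V, is_ideal I -> I `<=` [set 0] \/ I = [set: V].

Definition proper_graded_ideal V (I : set V) : Prop :=
  [/\ is_ideal I, graded_for (@weight S V) I & I <> [set: V]].

Definition maximal_graded_ideal V (I : set V) : Prop :=
  proper_graded_ideal I /\
  forall I' : set V, proper_graded_ideal I' -> I `<=` I' -> I' = I.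

End VertexSuperalgebras.

(* Homomorphisms of weight graded vertex superalgebras along h : S -> S'. *)
Definition is_vhom (S S' : comNzRingType) (h : S -> S')
    (V : vertexSuperalgebra S) (W : vertexSuperalgebra S')
    (f : V -> W) : Prop :=
  [/\ semilinear h f, f (vac V) = vac W,
      forall n a b, f (a \circ_n b) = f a \circ_n f b,
      forall p a, parity p a -> parity p (f a)
    & forall m a, weight m a -> weight m (f a)].

Definition is_quotient (S : comNzRingType) (V W : vertexSuperalgebra S)
    (I : set V) (f : V -> W) : Prop :=
  [/\ is_vhom id f, forall w, exists v, f v = w & forall v, f v = 0 <-> I v].

(* Com(U, W), for the image of U in W under f. *)
Definition Com (S : comNzRingType) (U W : vertexSuperalgebra S)
    (f : U -> W) : set W :=
  [set w | forall (u : U) (n : nat), f u \circ_n w = 0].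

(* Free generation by even fields x_0, ..., x_(d-1): the ordered monomials
   x_(i_1) \circ_(-n_1-1) (x_(i_2) \circ_(-n_2-1) (... vac)), with
   i_1 <= i_2 <= ... and n_j >= n_(j+1) if i_j = i_(j+1), form a basis. *)
Definition pbw_le (d : nat) (x y : nat * 'I_d) : bool :=
  (x.2 < y.2)%N || (x.2 == y.2) && (y.1 <= x.1)%N.

Definition pbw_index (d : nat) : choiceType :=
  {s : seq (nat * 'I_d) | sorted (@pbw_le d) s}.

Definition freely_generated (S : comNzRingType) (V : vertexSuperalgebra S)
    (d : nat) (x : 'I_d -> V) : Prop :=
  is_basis (fun s : pbw_index d =>
    foldr (fun y v => x y.2 \circ_(- (y.1.+1)%:Z) v) (vac V) (val s)).

Definition is_heisenberg (S : comNzRingType) (d : nat)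
    (V : vertexSuperalgebra S) : Prop :=
  exists x : 'I_d -> V,
    [/\ forall i, parity false (x i) /\ weight 1 (x i),
        forall i j, x i \circ_1 x j = (i == j)%:R *: vac V,
        forall i j (n : nat), n != 1%N -> x i \circ_n x j = 0
      & freely_generated x].

(* tau exhibits T as the tensor product of V and W. In the product formula
   the sum is over all integers j = i - N. *)
Definition is_tensor (S : comNzRingType) (V W T : vertexSuperalgebra S)
    (tau : V -> W -> T) : Prop :=
  [/\ (forall a, linear (tau a)) /\ (forall b, linear (fun a => tau a b)),
      exists (I J : choiceType) (v : I -> V) (w : J -> W),
        [/\ is_basis v, is_basis w
          & is_basis (fun ij : I * J => tau (v ij.1) (w ij.2))],
      tau (vac V) (vac W) = vac T,
      (forall p q a b, parity p a -> parity q b ->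
         parity (p (+) q) (tau a b)) /\
      (forall m n a b, weight m a -> weight n b -> weight (m + n)%N (tau a b))
    & forall (n : int) (p q : bool) a b a' b', parity p b -> parity q a' ->
        exists N0 : nat, forall N : nat, (N0 <= N)%N ->
          tau a b \circ_n tau a' b' =
          (-1) ^+ (p && q) *:
          \sum_(i < (N + N)%N)
            tau (a \circ_(i%:Z - N%:Z) a')
                (b \circ_(n - 1 - (i%:Z - N%:Z)) b')].

Section Lie.
Variable F : fieldType.

Record lieAlgebra := LieAlgebra {
  lieV :> vectType F;
  bracket : lieV -> lieV -> lieV;
  bracket_linear_l : forall y, linear (fun x => bracket x y);
  bracket_linear_r : forall x, linear (bracket x);
  bracket_alt : forall x, bracket x x = 0;
  jacobi : forall x y z,
    bracket x (bracket y z) = bracket (bracket x y) z + bracket y (bracket x z)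
}.

Definition simple_lie (g : lieAlgebra) : Prop :=
  (exists x y : g, bracket x y != 0) /\
  forall U : {vspace g},
    (forall x u : g, u \in U -> bracket x u \in U) ->
    U = 0%VS \/ U = fullv.

(* The trace of ad x \o ad y. *)
Definition killing (g : lieAlgebra) (x y : g) : F :=
  \sum_(i < \dim {:g})
    coord (vbasis {:g}) i (bracket x (bracket y (tnth (vbasis {:g}) i))).

(* With hv the dual Coxeter number, the form for which long roots have square
   length 2. *)
Definition normalized_killing (g : lieAlgebra) (hv : F) (x y : g) : F :=
  killing x y / (2 * hv).

Section Roots.
Variables (g : lieAlgebra) (h : {vspace g}).

Definition toral (U : {vspace g}) : Prop :=
  (forall x y : g, x \in U -> y \in U -> bracket x y = 0) /\
  (forall x : g, x \in U -> semisimple_op (bracket x)).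

(* Cartan subalgebras of a semisimple Lie algebra. *)
Definition is_cartan : Prop :=
  toral h /\ forall U : {vspace g}, toral U -> (h <= U)%VS -> U = h.

Definition weightType := 'Hom(subvs_of h, F^o).

Definition root_space (a : weightType) : set g :=
  [set x | forall t : subvs_of h, bracket (vsval t) x = (a t : F) *: x].

Definition is_root (a : weightType) : Prop :=
  a != 0 /\ exists2 x : g, x != 0 & root_space a x.

Definition positive_system (pos : seq weightType) : Prop :=
  [/\ uniq pos, forall a, a \in pos -> is_root a,
      forall a, is_root a -> (a \in pos) = (- a \notin pos)
    & forall a b, a \in pos -> b \in pos -> is_root (a + b) -> a + b \in pos].

Definition highest_root (pos : seq weightType) (theta : weightType) : Prop :=
  theta \in pos /\
  forall b, is_root b ->
    exists c : weightType -> nat, theta - b = \sum_(a <- pos) a *+ c a.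

Definition is_coroot (a : weightType) (t : subvs_of h) : Prop :=
  (exists x y : g,
     [/\ root_space a x, root_space (- a) y & vsval t = bracket x y]) /\
  a t = 2 :> F.

Definition half_sum (pos : seq weightType) : weightType :=
  2^-1 *: \sum_(a <- pos) a.

(* 1 + <rho, theta^vee>, with theta the highest root. *)
Definition is_dual_coxeter (pos : seq weightType) (hv : F) : Prop :=
  exists (theta : weightType) (t : subvs_of h),
    [/\ highest_root pos theta, is_coroot theta t
      & hv = 1 + (half_sum pos t : F)].

End Roots.
End Lie.

(* The rational functions p/q in kappa with deg p <= deg q and all roots of q
   in K. *)
Section RationalFunctions.
Variables (R : realType) (K : set (Cx R)).
Local Notation C := (Cx R).
Local Notation "p %:F" := (tofrac p).

Definition is_fraction (f : {fraction {poly C}}) (p q : {poly C}) : Prop :=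
  [/\ q != 0, forall z, root q z -> K z, (size p <= size q)%N
    & f = p%:F / q%:F].

Definition FK_pred : {pred {fraction {poly C}}} :=
  fun f => `[< exists p q, is_fraction f p q >].

Lemma FK_subring : subring_closed FK_pred.
Proof.
split.
- apply/asboolP; exists 1, 1; split=> [|z||]; rewrite ?oner_eq0 //.
  + by rewrite (negPf (root1 z)).
  + by rewrite divr1.
- move=> f1 f2 /asboolP [p1 [q1 [n1 r1 s1 ->]]] /asboolP [p2 [q2 [n2 r2 s2 ->]]].
  apply/asboolP; exists (p1 * q2 - p2 * q1), (q1 * q2); split.
  + by rewrite mulf_neq0.
  + by move=> z; rewrite rootM => /orP [/r1|/r2].
  + have bnd (p q q' : {poly C}) : q' != 0 -> q != 0 -> (size p <= size q)%N ->
        (size (p * q')%R <= size (q * q')%R)%N.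
      move=> n' n0 le; rewrite (size_mul n0 n').
      apply: (leq_trans (size_polyMleq _ _)).
      by rewrite -!subn1 leq_sub2r // leq_add2r.
    apply: (leq_trans (size_polyD _ _)); rewrite size_polyN geq_max.
    by rewrite bnd //= [q1 * q2]mulrC bnd.
  + rewrite !(tofracM, tofracB) -mulNr addf_div ?tofrac_eq0 //.
    by rewrite mulNr.
- move=> f1 f2 /asboolP [p1 [q1 [n1 r1 s1 ->]]] /asboolP [p2 [q2 [n2 r2 s2 ->]]].
  apply/asboolP; exists (p1 * p2), (q1 * q2); split.
  + by rewrite mulf_neq0.
  + by move=> z; rewrite rootM => /orP [/r1|/r2].
  + rewrite (size_mul n1 n2); apply: (leq_trans (size_polyMleq _ _)).
    by rewrite -!subn1 leq_sub2r // leq_add.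
  + by rewrite !tofracM mulf_div.
Qed.

HB.instance Definition _ := GRing.isSubringClosed.Build _ FK_pred FK_subring.

Record FK := MkFK { FKval : {fraction {poly C}}; _ : FKval \in FK_pred }.

HB.instance Definition _ := [isSub for FKval].
HB.instance Definition _ := [Choice of FK by <:].
HB.instance Definition _ := [SubChoice_isSubComNzRing of FK by <:].

Lemma FK_fraction (f : FK) :
  exists pq : {poly C} * {poly C}, is_fraction (val f) pq.1 pq.2.
Proof. by have /asboolP [p [q ?]] := valP f; exists (p, q). Qed.

Definition FK_repr (f : FK) : {poly C} * {poly C} :=
  projT1 (cid (FK_fraction f)).

Lemma FK_reprP (f : FK) :
  is_fraction (val f) (FK_repr f).1 (FK_repr f).2.
Proof. exact: projT2 (cid (FK_fraction f)). Qed.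

(* The value at kappa = s, for s not in K. *)
Definition FK_eval (s : C) (f : FK) : C :=
  (FK_repr f).1.[s] / (FK_repr f).2.[s].

(* The limit for kappa -> oo: the quotient of the coefficients of degree
   deg q of p and q. *)
Definition FK_lim (f : FK) : C :=
  (FK_repr f).1`_(size (FK_repr f).2).-1 / lead_coef (FK_repr f).2.

Lemma is_fraction_cross (f : {fraction {poly C}}) p q p' q' :
  is_fraction f p q -> is_fraction f p' q' -> p * q' = p' * q.
Proof.
move=> [n r s ->] [n' r' s' /eqP].
by rewrite eqr_div ?tofrac_eq0 // -!tofracM tofrac_eq => /eqP.
Qed.

Lemma FK_evalE (s : C) (f : FK) p q : ~ K s ->
  is_fraction (val f) p q -> FK_eval s f = p.[s] / q.[s].
Proof.
move=> Ks fpq; have fr := FK_reprP f.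
have cr := is_fraction_cross fr fpq.
have nz p' q' : is_fraction (val f) p' q' -> q'.[s] != 0.
  by move=> [_ r _ _]; apply/negP => q0; apply: Ks; exact: r.
apply/eqP; rewrite /FK_eval eqr_div ?(nz _ _ fr) ?(nz _ _ fpq) //.
by rewrite -!hornerM cr.
Qed.

Lemma FK_limE (f : FK) p q :
  is_fraction (val f) p q -> FK_lim f = p`_(size q).-1 / lead_coef q.
Proof.
move=> fpq; have fr := FK_reprP f; have cr := is_fraction_cross fr fpq.
have top (p' q' r : {poly C}) : q' != 0 -> r != 0 -> (size p' <= size q')%N ->
    (p' * r)`_((size q').-1 + (size r).-1) = p'`_(size q').-1 * lead_coef r.
  move=> n0 n1 le; rewrite coefM.
  have lt : ((size q').-1 < ((size q').-1 + (size r).-1).+1)%N.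
    by rewrite ltnS leq_addr.
  rewrite (bigD1 (Ordinal lt)) //= addKn big1 ?addr0 // => i.
  rewrite -val_eqE /= => ne; have [li|gi] := ltnP i (size q').-1.
    rewrite [r`_ _]nth_default ?mulr0 //.
    by apply: (leq_trans (leqSpred _)); rewrite ltn_subRL ltn_add2r.
  rewrite [p'`_ _]nth_default ?mul0r //; apply: (leq_trans le).
  have gi' : ((size q').-1 < i)%N by rewrite ltn_neqAle eq_sym ne.
  exact: leq_trans (leqSpred _) gi'.
case: fpq fr => [n _ s _] [n' _ s' _].
apply/eqP; rewrite /FK_lim eqr_div ?lead_coef_eq0 //.
by rewrite -!top // cr addnC.
Qed.

(* The constant c, and 1/kappa (junk unless K contains 0). *)
Definition FK_const (c : C) : FK := insubd 0 (c%:P)%:F.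
Definition kappa_inv : FK := insubd 0 ('X%:F)^-1.

End RationalFunctions.

(* The inclusion of F_K into F_K', for K included in K'. *)
Definition FK_incl (R : realType) (K K' : set (Cx R)) (f : FK K) : FK K' :=
  insubd 0 (val f).

Section DeformableFamilies.
Variables (R : realType) (K : set (Cx R)).
Local Notation C := (Cx R).

Definition is_deformable (B : vertexSuperalgebra (FK K)) : Prop :=
  [/\ exists (I : choiceType) (b : I -> B),
        is_basis b /\ (forall i, exists m, weight m (b i)),
      forall m, fin_dim (@weight _ B m)
    & has_dim (@weight _ B 0) 1].

(* phi is the map f_i a_i |-> (lim f_i) alpha_i. *)
Definition is_limit (B : vertexSuperalgebra (FK K))
    (Binf : vertexSuperalgebra C) (phi : B -> Binf) : Prop :=
  is_vhom (@FK_lim R K) phi /\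
  exists (I : choiceType) (a : I -> B),
    [/\ is_basis a, forall i, exists m, weight m (a i)
      & is_basis (fun i => phi (a i))].

(* sp exhibits Bs as B/(kappa - s), for s not in K. As kappa itself is not in
   F_K, the ideal of F_K meant by (kappa - s) is the ideal of functions
   vanishing at s, which is generated by (kappa - s)/kappa if K contains 0. *)
Definition is_specialization (s : C) (B : vertexSuperalgebra (FK K))
    (Bs : vertexSuperalgebra C) (sp : B -> Bs) : Prop :=
  [/\ is_vhom (@FK_eval R K s) sp, forall w, exists v, sp v = w
    & forall v, sp v = 0 <->
        exists v', v = (1 - FK_const K s * kappa_inv K) *: v'].

End DeformableFamilies.

Section Affine.
Variables (R : realType) (g : lieAlgebra (Cx R)) (hv : Cx R).
Local Notation C := (Cx R).

(* V is a vertex algebra over the algebra S (with structure map iota) freely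
   generated by the fields x^xi, with
   x^xi(z) x^eta(w) ~ lev B(xi,eta)/(z-w)^2 + b x^[xi,eta](w)/(z-w). *)
Definition is_affine (S : comNzRingType) (iota : C -> S) (lev b : S)
    (V : vertexSuperalgebra S) (x : g -> V) : Prop :=
  [/\ forall c u v, x (c *: u + v) = iota c *: x u + x v,
      forall u, parity false (x u) /\ weight 1 (x u),
      forall u v, x u \circ_0 x v = b *: x (bracket u v) /\
        x u \circ_1 x v = (lev * iota (normalized_killing hv u v)) *: vac V,
      forall u v (n : nat), (2 <= n)%N -> x u \circ_n x v = 0
    & forall e : (\dim {:g}).-tuple g, basis_of {:g} e ->
        freely_generated (fun i => x (tnth e i))].

Definition is_universal_affine (k : C) (V : vertexSuperalgebra C)
    (X : g -> V) : Prop :=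
  is_affine id k 1 X.

(* The deformable family over F_{0} specializing to V^k(g). *)
Definition is_affine_family (V : vertexSuperalgebra (FK [set (0 : C)]))
    (a : g -> V) : Prop :=
  is_affine (@FK_const R _) 1 (kappa_inv _) a.

Definition is_sugawara (k : C) (V : vertexSuperalgebra C) (X : g -> V)
    (L : V) : Prop :=
  exists e e' : (\dim {:g}).-tuple g,
    [/\ basis_of {:g} e,
        forall i j, normalized_killing hv (tnth e i) (tnth e' j) = (i == j)%:R
      & L = (2 * (k + hv))^-1 *:
              \sum_(i < \dim {:g}) X (tnth e i) \circ_(- 1) X (tnth e' i)].

End Affine.

Section Complex.
Variables (R : realType).
Local Notation C := (Cx R).
Implicit Types V W : vertexSuperalgebra C.

(* L is a Virasoro element for which the weight grading of V is the grading
   by conformal weight, that is by eigenvalues of L_0. *)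
Definition is_conformal V (L : V) : Prop :=
  [/\ parity false L,
      exists c : C, L \circ_3 L = (c / 2) *: vac V,
      [/\ L \circ_0 L = translation L, L \circ_1 L = 2 *: L, L \circ_2 L = 0
        & forall n : nat, (4 <= n)%N -> L \circ_n L = 0],
      forall a, L \circ_0 a = translation a
    & forall m a, weight m a -> L \circ_1 a = m%:R *: a].

Definition is_simple_graded_quotient V W (q : V -> W) : Prop :=
  exists2 I : set V, maximal_graded_ideal I & is_quotient I q.

Definition generic (P : C -> Prop) : Prop :=
  exists2 E : set C, countable E & forall k, ~ E k -> P k.

(* The structure constants of the family (A k), k in D, depend continuously on
   k in suitable homogeneous bases. *)
Definition continuous_structure_constants (D : set C)
    (A : C -> vertexSuperalgebra C) : Prop :=
  exists (I : choiceType) (wt : I -> nat) (pa : I -> bool)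
         (e : forall k, I -> A k),
    (forall k, D k -> is_basis (e k) /\
       forall i, weight (wt i) (e k i) /\ parity (pa i) (e k i)) /\
    forall (i j : I) (n : int),
      exists (s : seq I) (c : I -> C -> C),
        (forall l, {within D, continuous (c l)}) /\
        forall k, D k -> e k i \circ_n e k j = \sum_(l <- s) c l k *: e k l.

(* Operators and matrices. The exponential series of a locally finite operator
   converges on each finite-dimensional invariant subspace; this is expressed
   by applying linear functionals. *)
Definition is_exp (W : lmodType C) (T E : W -> W) : Prop :=
  forall (w : W) (phi : {linear W -> C^o}),
    (fun N : nat => \sum_(n < N) phi (iter n T w) / (n`!)%:R : C) @ \oo
      --> (phi (E w) : C).

Definition is_mx_exp (N : nat) (Y E : 'M[C]_N) : Prop :=
  forall i j,
    (fun M : nat => \sum_(n < M) (iter n (mulmx Y) 1%:M) i j / (n`!)%:R : C)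
      @ \oo --> (E i j : C).

(* Closed connected subgroups of GL_N(C). *)
Definition connected_matrix_group (N : nat) (G : set 'M[C]_N) : Prop :=
  [/\ G 1%:M, forall x y, G x -> G y -> G (x *m y),
      forall x, G x -> G (invmx x),
      exists2 Z : set 'M[C]_N, closed Z & G = Z `&` [set x | x \in unitmx]
    & connected G].

(* lam identifies g with the Lie algebra of G. *)
Definition is_lie_algebra_of (g : lieAlgebra C) (N : nat) (G : set 'M[C]_N)
    (lam : g -> 'M[C]_N) : Prop :=
  [/\ linear lam, injective lam,
      forall x y, lam (bracket x y) = lam x *m lam y - lam y *m lam x
    & forall Y, (exists x, lam x = Y) <->
        forall (t : C) (E : 'M[C]_N), t \is Num.real ->
          is_mx_exp (t *: Y) E -> G E].

(* sig is a linear action of G on W integrating the action rho of g. *)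
Definition integrates (g : lieAlgebra C) (N : nat) (G : set 'M[C]_N)
    (lam : g -> 'M[C]_N) (W : lmodType C) (rho : g -> W -> W)
    (sig : 'M[C]_N -> W -> W) : Prop :=
  [/\ forall x, G x -> linear (sig x),
      forall w, sig 1%:M w = w,
      forall x y w, G x -> G y -> sig (x *m y) w = sig x (sig y w)
    & forall xi E, is_mx_exp (lam xi) E -> is_exp (rho xi) (sig E)].

(* W is a direct sum of finite-dimensional g-modules, g acting by rho. *)
Definition locally_finite_decomposition (g : lieAlgebra C) (W : lmodType C)
    (rho : g -> W -> W) : Prop :=
  exists (I : choiceType) (M : I -> set W),
    [/\ direct_sum M, forall i, fin_dim (M i)
      & forall i xi w, M i w -> M i (rho xi w)].

End Complex.

(* The standing assumptions on a family A of vertex superalgebras with maps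
   f k : V^k(g) -> A k, where A k and f k are meaningful for sqrtk k not in K.
   The operator kappa a^xi \circ_0 on the deformable family, which specializes to the
   action X^xi \circ_0 of g on A k, need not be defined a priori; that it is
   defined, and the resulting action rho of g on the limit, are expressed by
   the condition relating rho and phi. *)
Section Good.
Variables (R : realType) (g : lieAlgebra (Cx R)) (h : {vspace g}).
Variables (pos : seq (weightType h)) (hv : Cx R).
Local Notation C := (Cx R).
Variables (V : C -> vertexSuperalgebra C) (X : forall k, g -> V k).
Variables (sqrtk : C -> C) (K : set C).
Variables (A : C -> vertexSuperalgebra C) (f : forall k, V k -> A k).

Definition parameters : set C := [set k | ~ K (sqrtk k)].

Definition family_condition (Vf : vertexSuperalgebra (FK [set (0 : C)]))
    (a : g -> Vf) (Af : vertexSuperalgebra (FK K)) (Phi : Vf -> Af) : Prop :=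
  [/\ is_affine_family hv a, is_deformable Af,
      is_vhom (@FK_incl R _ K) Phi
    & forall k, parameters k ->
        exists (spV : Vf -> V k) (spA : Af -> A k),
          [/\ is_specialization (sqrtk k) spV,
              forall xi, spV (a xi) = (sqrtk k)^-1 *: X k xi,
              is_specialization (sqrtk k) spA
            & forall v, spA (Phi v) = f (spV v)]].

Definition conformal_condition : Prop :=
  exists dims : nat -> nat, generic (fun k =>
    (exists L : A k, is_conformal L) /\
    forall d, has_dim (@weight _ (A k) d) (dims d)).

Definition g_action (k : C) (xi : g) (w : A k) : A k :=
  f (X k xi) \circ_0 w.

Definition integrable_condition (N : nat) (G : set 'M[C]_N)
    (lam : g -> 'M[C]_N) : Prop :=
  generic (fun k =>
    locally_finite_decomposition (@g_action k) /\
    exists sig, integrates G lam (@g_action k) sig).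

Definition limit_condition (N : nat) (G : set 'M[C]_N) (lam : g -> 'M[C]_N)
    (Vf : vertexSuperalgebra (FK [set (0 : C)])) (a : g -> Vf)
    (Af : vertexSuperalgebra (FK K)) (Phi : Vf -> Af) : Prop :=
  exists (Ainf : vertexSuperalgebra C) (phi : Af -> Ainf),
    is_limit phi /\
  exists (H At : vertexSuperalgebra C) (inc : At -> Ainf)
         (tau : H -> At -> Ainf),
    [/\ is_heisenberg (\dim {:g}) H,
        is_vhom id inc /\ injective inc,
        is_tensor tau /\ (forall w, tau (vac H) w = inc w),
        (exists L : At, is_conformal L) /\
        (forall m, fin_dim (@weight _ At m))
      & exists (rho : g -> Ainf -> Ainf) (sig : 'M[C]_N -> Ainf -> Ainf),
          [/\ forall xi v, exists2 v',
                  Phi (a xi) \circ_0 v = kappa_inv K *: v'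
                & rho xi (phi v) = phi v',
              integrates G lam rho sig
            & forall x w, G x -> exists w', sig x (inc w) = inc w']].

Definition highest_weight_vector (k : C) (v : A k) : Prop :=
  [/\ v != 0,
      forall xi (n : nat), (1 <= n)%N -> f (X k xi) \circ_n v = 0,
      forall b xi, b \in pos -> root_space b xi -> f (X k xi) \circ_0 v = 0
    & forall xi, xi \in h -> exists c : C, f (X k xi) \circ_0 v = c *: v].

(* The V^k(g)-submodule generated by v. *)
Definition generated_submodule (k : C) (v : A k) : set (A k) :=
  [set w | forall M : set (A k), submodule M ->
     (forall (u : V k) n m, M m -> M (f u \circ_n m)) -> M v -> M w].

Definition highest_weight_condition : Prop :=
  generic (fun k =>
    forall (v : A k) (L : V k) (a : C),
      highest_weight_vector v -> is_sugawara hv k (X k) L ->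
      fin_dim (generated_submodule v `&`
               gen_eigenspace (fun w => f L \circ_1 w) a)).

Definition good : Prop :=
  [/\ countable K /\ K 0,
      continuous_structure_constants parameters A,
      forall k, parameters k -> is_vhom id (@f k)
    & exists (Vf : vertexSuperalgebra (FK [set (0 : C)])) (a : g -> Vf)
             (Af : vertexSuperalgebra (FK K)) (Phi : Vf -> Af)
             (N : nat) (G : set 'M[C]_N) (lam : g -> 'M[C]_N),
        connected_matrix_group G /\ is_lie_algebra_of G lam /\
        [/\ family_condition a Phi, conformal_condition,
            integrable_condition G lam, limit_condition G lam a Phi
          & highest_weight_condition]].

End Good.

(* Main.v *)
Require Import Defs.
From HB Require Import structures.
From mathcomp Require Import all_boot all_order all_algebra.
From mathcomp Require Import ring zify.
From mathcomp Require Import complex.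
From mathcomp Require Import boolp classical_sets functions cardinality reals.
From mathcomp Require Import topology normedtype sequences.
Set Implicit Arguments.
Unset Strict Implicit.
Unset Printing Implicit Defensive.
Import Order.TTheory GRing.Theory Num.Theory numFieldNormedType.Exports.
Local Open Scope classical_set_scope.
Local Open Scope ring_scope.

(** Let T be, up to a positive factor, the operator of the first product with
   the Sugawara vector of V^k(g), acting on A^k. A lift to C^k of a vector w of
   C_k is obtained by spectral projection.

   Take any lift v0 of w. The quotient map intertwines T with the Sugawara
   operator of A_k, which kills w, and v0 lies in a finite-dimensional
   T-invariant space because the weight spaces are finite-dimensional. Hence the
   component v of v0 in the generalized kernel of T is again a lift of w
   ([gen_kernel_lift]). It remains to see that the generalized kernel of T is
   contained in C^k, i.e. that it is killed by the modes X_n with n >= 0 of the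
   currents ([sugawara_gen_kernel]); the other elements of V^k(g) then follow
   since the currents generate ([Com_of_currents]).

   A current mode X_n shifts the eigenvalues of T by - n (1 + 2 c), where
   1 + 2 c = (k + hv) / hv is positive. So it suffices that T has no negative
   eigenvalue and that g acts trivially on the generalized kernel. Positive
   modes also lower the conformal weight, so an induction on the weight reduces
   both assertions to singular vectors, those killed by all positive modes. The
   singular vectors of bounded weight form a finite-dimensional g-module, on
   which T is the Casimir operator Omega of the Killing form kappa.

   On a generalized eigenspace U of Omega with eigenvalue b, the trace form is
   invariant, hence equal to mu kappa for a scalar mu by Schur's lemma, and
   taking the trace of Omega gives b dim U = mu dim g ([casimir_ge0]). The coroot
   t of the highest root is part of an sl2-triple, so it has integral eigenvalues
   in every finite-dimensional module; thus the trace of t^2 is nonnegative on U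
   and positive on g, and mu >= 0. If b = 0, then mu = 0 and t has no nonzero
   weight on U, so that the raising operator of the triple acts by 0; the kernel
   of the action being an ideal, g acts trivially.

   The same positivity of kappa on t shows that kappa is nondegenerate. The dual
   Coxeter number is positive because the reflection in the highest root theta
   cancels the negative terms of the sum of a(t) over the positive roots a
   against positive ones, and leaves over at least theta(t) = 2 ([sum_pos_ge2]). *)

(** * Representations of sl2 *)

Definition sl2_action (F : numFieldType) (W : lmodType F)
    (E D H : {linear W -> W}) : Prop :=
  [/\ forall w, H (E w) = E (H w) + 2 *: E w,
      forall w, H (D w) = D (H w) - 2 *: D w
    & forall w, E (D w) = D (E w) + H w].

(** All that is used of finite-dimensionality: strings of weights end. *)
Definition finite_spectrum (F : numFieldType) (W : lmodType F)
    (H : W -> W) : Prop :=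
  exists d : nat, forall rs : seq F, uniq rs ->
    (forall a, a \in rs -> exists2 v, v != 0 & H v = a *: v) ->
    (size rs <= d)%N.

Section Sl2.
Variables (F : numFieldType) (W : lmodType F) (E D H : {linear W -> W}).
Hypothesis sl2 : sl2_action E D H.
Hypothesis fin : finite_spectrum H.

Lemma sl2_iter_raise n v (a : F) :
  H v = a *: v -> H (iter n E v) = (a + 2 * n%:R) *: iter n E v.
Proof.
case: sl2 => HE _ _ Hv; elim: n => [|n IHn] /=; first by rewrite mulr0 addr0.
rewrite HE IHn linearZ /= -scalerDl -addrA -[in RHS]natr1; congr (_ *: _); ring.
Qed.

Lemma sl2_iter_lower n v (a : F) :
  H v = a *: v -> H (iter n D v) = (a - 2 * n%:R) *: iter n D v.
Proof.
case: sl2 => _ HD _ Hv; elim: n => [|n IHn] /=; first by rewrite mulr0 subr0.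
rewrite HD IHn linearZ /= -scalerBl -[in RHS]natr1; congr (_ *: _); ring.
Qed.

Lemma sl2_raise_lower n v (a : F) : H v = a *: v ->
  E (iter n.+1 D v) =
  (n.+1%:R * (a - n%:R)) *: iter n D v + iter n.+1 D (E v).
Proof.
case: (sl2) => _ _ ED Hv; elim: n => [|n IHn].
  by rewrite /= ED Hv mul1r subr0 addrC.
rewrite [in LHS]iterS ED IHn (sl2_iter_lower n.+1 Hv) linearD linearZ /=.
rewrite addrAC -scalerDl -(natr1 n.+1) -(natr1 n); congr (_ *: _ + _).
ring.
Qed.

Lemma sl2_lower_raise n v (a : F) : H v = a *: v ->
  D (iter n.+1 E v) =
  iter n.+1 E (D v) - (n.+1%:R * (a + n%:R)) *: iter n E v.
Proof.
case: (sl2) => _ _ ED Hv.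
have DE w : D (E w) = E (D w) - H w by rewrite ED addrK.
elim: n => [|n IHn]; first by rewrite /= DE Hv mul1r addr0.
rewrite [in LHS]iterS DE IHn (sl2_iter_raise n.+1 Hv) linearB linearZ /=.
rewrite -addrA -opprD -scalerDl -(natr1 n.+1) -(natr1 n).
congr (_ - _ *: _); ring.
Qed.

(** Nonzero vectors w n of weights a + s n would be eigenvectors for infinitely
   many eigenvalues. *)
Lemma sl2_finite_string (a s : F) (w : nat -> W) : s != 0 ->
  (forall n, H (w n) = (a + s * n%:R) *: w n) -> exists n, w n = 0.
Proof.
move=> s0 Hw; apply: contrapT => wN0.
have {wN0}w0 n : w n != 0 by apply/eqP => wn; apply: wN0; exists n.
have [d] := fin.
move/(_ [seq a + s * n%:R | n <- iota 0 d.+1]).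
rewrite size_map size_iota ltnn => contra; suff: false by []; apply: contra.
  rewrite map_inj_uniq ?iota_uniq // => m n /addrI /(mulfI s0) /eqP.
  by rewrite eqr_nat => /eqP.
by move=> b /mapP[n _ ->]; exists (w n).
Qed.

Lemma sl2_raise_nilpotent v (a : F) : H v = a *: v -> exists n, iter n E v = 0.
Proof.
move=> Hv; apply: (@sl2_finite_string a 2) => [|n]; first by rewrite pnatr_eq0.
exact: sl2_iter_raise.
Qed.

Lemma sl2_lower_nilpotent v (a : F) : H v = a *: v -> exists n, iter n D v = 0.
Proof.
move=> Hv; apply: (@sl2_finite_string a (- 2)) => [|n].
  by rewrite oppr_eq0 pnatr_eq0.
by rewrite mulNr; exact: sl2_iter_lower.
Qed.

(** In the string of a highest weight vector of weight a, the coefficient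
   n (a - n + 1) has to vanish at the step where the string ends. *)
Lemma sl2_highest_weight v (a : F) :
  v != 0 -> H v = a *: v -> E v = 0 -> exists n : nat, a = n%:R.
Proof.
move=> v0 Hv Ev.
have [n0] := sl2_lower_nilpotent Hv.
elim: n0 => [/eqP|n IHn]; first by rewrite (negPf v0).
have [/IHn //|Dn Dn1] := eqVneq (iter n D v) 0.
have := sl2_raise_lower n Hv; rewrite Dn1 Ev linear0.
rewrite (_ : iter n.+1 D 0 = 0); last by elim: (n.+1) => //= m ->; rewrite linear0.
rewrite addr0 => /esym/eqP; rewrite scaler_eq0 (negPf Dn) orbF.
by rewrite mulf_eq0 pnatr_eq0 /= subr_eq0 => /eqP; exists n.
Qed.

(** Raising a weight vector ends in a highest weight vector, whose weight is a
   natural number and differs from the given one by an even number. *)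
Lemma sl2_integral_weight v (a : F) :
  v != 0 -> H v = a *: v -> exists z : int, a = z%:~R.
Proof.
move=> v0 Hv; have [n0] := sl2_raise_nilpotent Hv.
elim: n0 => [/eqP|n IHn]; first by rewrite (negPf v0).
have [/IHn //|En En1] := eqVneq (iter n E v) 0.
have [m am] := sl2_highest_weight En (sl2_iter_raise n Hv) En1.
exists (m%:Z - 2 * n%:Z).
by rewrite intrD rmorphN rmorphM /= -!pmulrn -am addrK.
Qed.

(** The reflection of weights: E^m is injective on the weight space of weight
   -m. On lowest weight vectors E can be undone step by step, since the
   coefficients j (m - j + 1) with 1 <= j <= m are nonzero; a vector z is
   reduced to that case by passing to D z, of weight -(m+2). *)
Lemma sl2_raise_injective (m : nat) z :
  H z = - m%:R *: z -> iter m E z = 0 -> z = 0.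
Proof.
move=> Hz Emz; have [n0] := sl2_lower_nilpotent Hz.
elim: n0 m z Hz Emz => // n IHn m z Hz Emz Dz.
have {IHn Dz}Dz : D z = 0.
  apply: (IHn m.+2); last by rewrite -iterSr.
    have /= -> := sl2_iter_lower 1 Hz; congr (_ *: _).
    by rewrite mulr1 -opprD -natrD addn2.
  have Em1 : iter m.+1 E z = 0 by rewrite iterS Emz linear0.
  have Em2 : iter m.+2 E z = 0 by rewrite iterS Em1 linear0.
  have := sl2_lower_raise m.+1 Hz.
  by rewrite Em2 Em1 linear0 scaler0 subr0 => <-.
have step j : (j < m)%N -> iter j.+1 E z = 0 -> iter j E z = 0.
  move=> jm Ej; have := sl2_lower_raise j Hz; rewrite Ej Dz linear0.
  rewrite (_ : iter _ E 0 = 0); last by elim: (j.+1) => //= i ->; rewrite linear0.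
  rewrite sub0r => /esym/eqP; rewrite oppr_eq0 scaler_eq0 mulf_eq0 pnatr_eq0 /=.
  by rewrite addrC subr_eq0 eqr_nat (ltn_eqF jm) => /eqP.
elim: m Emz {Hz} step => // m IHm Em step; apply: IHm.
  exact: step Em.
by move=> j jm; apply: step; rewrite ltnS ltnW.
Qed.

Lemma sl2_reflect (m j : nat) z : H z = - m%:R *: z -> z != 0 -> (j <= m)%N ->
  iter j E z != 0.
Proof.
move=> Hz z0 /subnK jm; apply: contraNN z0 => /eqP Ej.
apply/eqP/(sl2_raise_injective Hz); rewrite -jm iterD Ej.
by elim: (m - j)%N => //= i ->; rewrite linear0.
Qed.

End Sl2.

(** * Traces and eigenvalues of complex matrices *)

Section Eigenvalues.
Variable C : numClosedFieldType.

(** By triangularization: d is the diagonal of a triangular conjugate of A. *)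
Lemma mxtrace_eigenvalues n (A : 'M[C]_n) : exists d : 'I_n -> C,
  [/\ forall a, eigenvalue A a <-> exists i, a = d i, \tr A = \sum_i d i
    & \tr (A *m A) = \sum_i d i ^+ 2].
Proof.
case: n A => [A|n A].
  exists (fun=> 0); split; rewrite /mxtrace ?big_ord0 // => a.
  split=> [/eigenvalueP[v _]|[[]] //]; by rewrite thinmx0 eqxx.
have [P /unitarymx_unit Pu] := Schur A isT.
rewrite /= /similar_to conjumx //; set B := _ *m _ => Bt.
have AB : A = invmx P *m B *m P by rewrite /B !mulmxA mulVmx // mul1mx mulmxKV.
have BA : B = P *m A *m invmx P by [].
clearbody B.
have eqAB a : eigenvalue A a = eigenvalue B a.
  apply/eigenvalueP/eigenvalueP => -[v vM v0].
    exists (v *m invmx P); first by rewrite BA !mulmxA mulmxKV // vM scalemxAl.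
    by apply: contraNN v0 => /eqP vP; rewrite -[v](mulmxKV Pu) vP mul0mx.
  exists (v *m P); first by rewrite AB !mulmxA mulmxK // vM scalemxAl.
  by apply: contraNN v0 => /eqP vP; rewrite -[v](mulmxK Pu) vP mul0mx.
exists (fun i => B i i); split=> [a||].
- rewrite eqAB eigenvalue_root_char char_poly_trig //.
  rewrite rootE horner_prod prodf_seq_eq0; split.
    move/hasP => [i _ /=]; rewrite -rootE root_XsubC => /eqP ->; by exists i.
  move=> [i ->]; apply/hasP; exists i; first by rewrite mem_index_enum.
  by rewrite /= -rootE root_XsubC.
- by rewrite AB mxtrace_mulC mulmxA mulmxV // mul1mx.
- have -> : A *m A = invmx P *m (B *m B) *m P.
    by rewrite AB !mulmxA mulmxK.
  rewrite mxtrace_mulC mulmxA mulmxV // mul1mx; apply: eq_bigr => i _.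
  rewrite mxE (bigD1 i) //= big1 ?addr0 ?expr2 // => j ji.
  have /is_trig_mxP Bt' := Bt.
  have [ij|ij] := ltnP i j; first by rewrite Bt' ?mul0r.
  by rewrite [B j i]Bt' ?mulr0 // ltn_neqAle ij andbT.
Qed.

Lemma eigenvalue_exists n (A : 'M[C]_n) : (0 < n)%N -> exists a, eigenvalue A a.
Proof.
move=> n0; have [d [dA _ _]] := mxtrace_eigenvalues A.
by exists (d (Ordinal n0)); apply/dA; exists (Ordinal n0).
Qed.

Lemma finite_spectrum_mx n (A : 'M[C]_n) :
  finite_spectrum (fun v : 'rV[C]_n => v *m A).
Proof.
exists n => rs urs rsA; rewrite -ltnS -(size_char_poly A).
apply: max_poly_roots => //; first by rewrite monic_neq0 ?char_poly_monic.
apply/allP => a /rsA[v v0 vA]; rewrite -eigenvalue_root_char.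
by apply/eigenvalueP; exists v.
Qed.

Lemma nilpotent_of_spectrum n (A : 'M[C]_n) :
  (forall a, eigenvalue A a -> a = 0) -> iter n (mulmx A) 1%:M = 0.
Proof.
case: n A => [A|n A] A0; first by rewrite [LHS]flatmx0.
have [rs Ars] := closed_field_poly_normal (char_poly A).
rewrite (monicP (char_poly_monic A)) scale1r in Ars.
have srs : size rs = n.+1.
  by apply/eqP; rewrite -eqSS -(size_char_poly A) Ars size_prod_XsubC.
have X : char_poly A = 'X ^+ n.+1.
  rewrite Ars big_seq (eq_bigr (fun=> 'X)) -?big_seq; last first.
    move=> z zrs; rewrite (A0 z) ?subr0 // eigenvalue_root_char Ars.
    by rewrite root_prod_XsubC.
  by rewrite big_const_seq count_predT srs iter_mulr_1.
have iterX m : iter m (mulmx A) 1%:M = A ^+ m.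
  by elim: m => //= m ->; rewrite exprS.
by rewrite iterX -(Cayley_Hamilton A) X rmorphXn /= horner_mx_X.
Qed.

End Eigenvalues.

(** * Subspaces given by predicates *)

Section Subspaces.
Variable F : fieldType.

Lemma submoduleD (V : lmodType F) (M : set V) x y :
  submodule M -> M x -> M y -> M (x + y).
Proof. by move=> [_ ML] Mx; rewrite -[x]scale1r; apply: ML. Qed.

Lemma submoduleZ (V : lmodType F) (M : set V) c x :
  submodule M -> M x -> M (c *: x).
Proof. by move=> [M0 ML] Mx; rewrite -[_ *: _]addr0; apply: ML. Qed.

Lemma submodule_sum (V : lmodType F) (M : set V) (J : Type) (r : seq J)
    (P : pred J) (v : J -> V) :
  submodule M -> (forall j, P j -> M (v j)) -> M (\sum_(j <- r | P j) v j).
Proof.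
move=> SM Mv; apply: (big_ind M) => //; first exact: SM.1.
by move=> x y; exact: submoduleD.
Qed.

Lemma linear_fun0 (V W : lmodType F) (f : V -> W) : linear f -> f 0 = 0.
Proof.
by move=> fl; have := fl (-1) 0 0; rewrite scaleN1r addr0 oppr0 scaleN1r addNr.
Qed.

Lemma linear_funZ (V W : lmodType F) (f : V -> W) c v :
  linear f -> f (c *: v) = c *: f v.
Proof. by move=> fl; have := fl c v 0; rewrite (linear_fun0 fl) !addr0. Qed.

Lemma linear_fun_sum (V W : lmodType F) (f : V -> W) (J : Type) (r : seq J)
    (P : pred J) (v : J -> V) :
  linear f -> f (\sum_(j <- r | P j) v j) = \sum_(j <- r | P j) f (v j).
Proof.
move=> fl; elim/big_rec2: _ => [|j s w _ <-]; first exact: linear_fun0.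
by have := fl 1 (v j) w; rewrite !scale1r.
Qed.

Lemma linear_combination (V W : lmodType F) (f : V -> W) (J : finType)
    (c : J -> F) (v : J -> V) :
  linear f -> f (\sum_j c j *: v j) = \sum_j c j *: f (v j).
Proof.
move=> fl; rewrite linear_fun_sum //; apply: eq_bigr => j _.
exact: linear_funZ.
Qed.

(** A subspace of maximal dimension contained in M is all of M. *)
Lemma submodule_vspace (V : vectType F) (M : set V) : submodule M ->
  exists U : {vspace V}, forall v, v \in U <-> M v.
Proof.
move=> SM.
pose P n := `[< exists U : {vspace V}, (forall v, v \in U -> M v) /\ \dim U = n >].
have P0 : exists n, P n.
  exists 0%N; apply/asboolP; exists 0%VS; rewrite dimv0; split=> // v.
  by rewrite memv0 => /eqP ->; exact: SM.1.
have bnd n : P n -> (n <= \dim {:V})%N.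
  by move=> /asboolP[U [_ <-]]; rewrite dimvS // subvf.
case: (ex_maxnP P0 bnd) => n /asboolP[U [UM dU]] max; exists U => v.
split=> [/UM //|Mv]; have : P (\dim (U + <[v]>)).
  apply/asboolP; exists (U + <[v]>)%VS; split=> // w.
  move=> /memv_addP[u uU [_ /vlineP[c ->] ->]].
  by apply: (submoduleD SM (UM _ uU)); exact: submoduleZ.
move=> /max; rewrite -dU => le; have := dimv_leqif_sup (addvSl U <[v]>).
move=> [le' /esym]; rewrite eqn_leq le le' /= => sub.
by apply: (subvP sub); rewrite (subvP (addvSr _ _)) // memv_line.
Qed.

End Subspaces.

(** * Invariant forms and representations of a simple Lie algebra *)

HB.instance Definition _ (F : fieldType) (g : lieAlgebra F) (x : g) :=
  GRing.isLinear.Build F g g *:%R (@bracket F g x) (bracket_linear_r x).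

Section Bracket.
Variables (F : fieldType) (g : lieAlgebra F).

Lemma bracketDl (x y z : g) : bracket (x + y) z = bracket x z + bracket y z.
Proof. by have := bracket_linear_l z 1 x y; rewrite !scale1r. Qed.

Lemma bracketC (x y : g) : bracket x y = - bracket y x.
Proof.
apply/eqP; rewrite -addr_eq0; apply/eqP; have := bracket_alt (x + y).
by rewrite bracketDl !linearD /= !bracket_alt add0r addr0.
Qed.

End Bracket.

Section Forms.
Variables (C : numClosedFieldType) (g : lieAlgebra C).

Definition invariant_form (b : g -> g -> C) : Prop :=
  [/\ forall y, linear (b^~ y : g -> C^o), forall x y, b x y = b y x
    & forall x y z, b (bracket x y) z = b x (bracket y z)].

Lemma simple_ideal (S : set g) : simple_lie g -> submodule S ->
  (forall x y, S y -> S (bracket x y)) -> (exists2 x, x != 0 & S x) ->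
  forall x, S x.
Proof.
move=> [_ simp] SM ideal [x x0 Sx] y.
have [U US] := submodule_vspace SM.
case: (simp U) => [u v /US/(ideal u)/US //|U0|Uf].
  by move: x0; have /US : S x by []; rewrite U0 memv0 => ->.
by apply/US; rewrite Uf memvf.
Qed.

Lemma invariant_form_linear (b : g -> g -> C) c x y z :
  invariant_form b -> b (c *: x + y) z = c * b x z + b y z.
Proof. by move=> [bl _ _]; exact: (bl z). Qed.

Lemma invariant_form0 (b : g -> g -> C) z : invariant_form b -> b 0 z = 0.
Proof.
by move=> [bl _ _]; exact: (linear_fun0 (bl z)).
Qed.

Lemma invariant_form_linear_r (b : g -> g -> C) y :
  invariant_form b -> linear (b y : g -> C^o).
Proof. by move=> [bl bC _] c z w; rewrite !(bC y); apply: bl. Qed.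

Lemma invariant_formNl (b : g -> g -> C) y z :
  invariant_form b -> b (- y) z = - b y z.
Proof.
move=> binv; have := invariant_form_linear (-1) y 0 z binv.
by rewrite invariant_form0 // !addr0 scaleN1r mulN1r.
Qed.

Lemma invariant_formNr (b : g -> g -> C) y z :
  invariant_form b -> b y (- z) = - b y z.
Proof. by move=> binv; case: (binv) => _ bC _; rewrite !(bC y) invariant_formNl. Qed.

Lemma invariant_form_suml (b : g -> g -> C) (J : finType) (c : J -> C) v z :
  invariant_form b -> b (\sum_j c j *: v j) z = \sum_j c j * b (v j) z.
Proof.
by move=> [bl _ _]; exact: (linear_combination c v (bl z)).
Qed.

(** The radical of an invariant form is an ideal. *)
Lemma invariant_form_nondegenerate (b : g -> g -> C) :
  simple_lie g -> invariant_form b -> (exists x y, b x y != 0) ->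
  forall x, (forall y, b x y = 0) -> x = 0.
Proof.
move=> simp binv [x0 [y0 b0]] x bx; apply/eqP; apply: contraT => xn0.
have rad : forall x, [set x | forall y, b x y = 0] x.
  apply: simple_ideal => //; last by exists x.
    split=> [y|c u v bu bv y]; first exact: invariant_form0.
    by rewrite invariant_form_linear // bu bv mulr0 addr0.
  move=> u v bv y; rewrite bracketC.
  have -> : - bracket v u = bracket v (- u) by rewrite linearN.
  by case: binv => _ _ ->; rewrite bv.
by have := rad x0 y0 => /eqP; rewrite (negPf b0).
Qed.

Lemma invariant_form_sum (b : g -> g -> C) (J : finType) (v : J -> g) z :
  invariant_form b -> b (\sum_j v j) z = \sum_j b (v j) z.
Proof. by move=> [bl _ _]; rewrite (linear_fun_sum _ _ _ (bl z)). Qed.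

Lemma vbasis_sum (x : g) :
  exists c : 'rV[C]_(\dim {:g}),
    x = \sum_i c 0 i *: tnth (vbasis {:g}) i.
Proof.
exists (\row_i coord (vbasis {:g}) i x).
rewrite {1}(coord_vbasis (memvf x)); apply: eq_bigr => i _.
by rewrite mxE (tnth_nth 0).
Qed.

Definition gram (b : g -> g -> C) : 'M[C]_(\dim {:g}) :=
  \matrix_(i, j) b (tnth (vbasis {:g}) i) (tnth (vbasis {:g}) j).

Lemma gramE (b : g -> g -> C) (v : 'rV[C]_(\dim {:g})) j :
  invariant_form b ->
  (v *m gram b) 0 j =
  b (\sum_i v 0 i *: tnth (vbasis {:g}) i) (tnth (vbasis {:g}) j).
Proof.
move=> binv; rewrite invariant_form_suml // mxE.
by apply: eq_bigr => i _; rewrite mxE.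
Qed.

Lemma invariant_form_ext (b : g -> g -> C) x : invariant_form b ->
  (forall j, b x (tnth (vbasis {:g}) j) = 0) -> forall y, b x y = 0.
Proof.
move=> binv bx y; have [c ->] := vbasis_sum y.
case: (binv) => _ bC _; rewrite bC invariant_form_suml // big1 // => i _.
by rewrite bC bx mulr0.
Qed.

Lemma vbasis_sum_eq0 (v : 'rV[C]_(\dim {:g})) :
  \sum_i v 0 i *: tnth (vbasis {:g}) i = 0 -> v = 0.
Proof.
move=> v0; have /freeP fr := basis_free (vbasisP {:g}).
apply/rowP => j; rewrite mxE; apply: (fr (fun i => v 0 i)).
by rewrite -[RHS]v0; apply: eq_bigr => i _; rewrite (tnth_nth 0).
Qed.

Lemma gram_unitmx (b : g -> g -> C) :
  invariant_form b -> (forall x, (forall y, b x y = 0) -> x = 0) ->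
  gram b \in unitmx.
Proof.
move=> binv nd; rewrite -row_free_unit; apply: inj_row_free => v vb.
apply/vbasis_sum_eq0/nd/invariant_form_ext => // j.
by rewrite -gramE // vb mxE.
Qed.

(** Dual bases; the two expansions make the sum of the e j (x) e' j a symmetric
   and invariant tensor. *)
Definition casimir_tensor (b : g -> g -> C) (J : finType) (e e' : J -> g) :=
  [/\ forall x, x = \sum_j b x (e' j) *: e j,
      forall x, x = \sum_j b x (e j) *: e' j
    & forall i j, b (e i) (e' j) = (i == j)%:R].

Lemma casimir_tensor_exists (b : g -> g -> C) :
  invariant_form b -> (forall x, (forall y, b x y = 0) -> x = 0) ->
  exists e' : 'I_(\dim {:g}) -> g, casimir_tensor b (tnth (vbasis {:g})) e'.
Proof.
move=> binv nd; have Ku := gram_unitmx binv nd; have [_ bC _] := binv.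
pose e' i := \sum_j invmx (gram b) i j *: tnth (vbasis {:g}) j.
have dual i j : b (tnth (vbasis {:g}) i) (e' j) = (i == j)%:R.
  rewrite bC invariant_form_suml //.
  transitivity ((invmx (gram b) *m gram b) j i).
    by rewrite mxE; apply: eq_bigr => k _; rewrite mxE.
  by rewrite mulVmx // mxE eq_sym.
exists e'; split=> // x.
  have [c {1 2}->] := vbasis_sum x; apply: eq_bigr => i _; congr (_ *: _).
  rewrite invariant_form_suml // (bigD1 i) //= dual eqxx mulr1 big1 ?addr0 //.
  by move=> j ji; rewrite dual (negPf ji) mulr0.
apply/eqP; rewrite -subr_eq0; apply/eqP/nd/invariant_form_ext => // k.
rewrite addrC -scaleN1r invariant_form_linear // invariant_form_suml //.
have dual' i : b (e' i) (tnth (vbasis {:g}) k) = (k == i)%:R by rewrite bC dual.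
rewrite (bigD1 k) //= dual' eqxx mulr1 big1 ?addr0 ?mulN1r ?addNr // => j jk.
by rewrite dual' eq_sym (negPf jk) mulr0.
Qed.

Section CasimirTensor.
Variables (b : g -> g -> C) (J : finType) (e e' : J -> g).
Hypotheses (binv : invariant_form b) (ct : casimir_tensor b e e').
Variables (W : lmodType C) (Phi : g -> g -> W).
Hypotheses (Phi_l : forall y, linear (Phi^~ y)) (Phi_r : forall x, linear (Phi x)).

Lemma casimir_tensorC : \sum_j Phi (e' j) (e j) = \sum_j Phi (e j) (e' j).
Proof.
case: (ct) => _ ex' _; case: (binv) => _ bC _.
transitivity (\sum_j \sum_i b (e j) (e i) *: Phi (e' j) (e' i)).
  by apply: eq_bigr => j _; rewrite {1}[e j]ex' [LHS](linear_combination _ _ (Phi_r _)).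
rewrite exchange_big; apply: eq_bigr => i _ /=.
apply/esym; rewrite {1}[e i]ex' [LHS](linear_combination _ _ (Phi_l _)).
by apply: eq_bigr => j _; rewrite bC.
Qed.

(** Expand [x, e j] and [x, e' j] in the two bases: by invariance the
   coefficients of the two double sums are opposite. *)
Lemma casimir_tensor_invariant x :
  \sum_j (Phi (bracket x (e j)) (e' j) + Phi (e j) (bracket x (e' j))) = 0.
Proof.
case: (ct) => ex ex' _; case: (binv) => _ bC bI.
rewrite big_split /=.
rewrite (eq_bigr (fun j => \sum_i b (bracket x (e j)) (e' i) *: Phi (e i) (e' j)));
  last by move=> j _; rewrite {1}[bracket _ _]ex (linear_combination _ _ (Phi_l _)).
rewrite [X in _ + X](eq_bigr
    (fun j => \sum_i b (bracket x (e' j)) (e i) *: Phi (e j) (e' i)));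
  last by move=> j _; rewrite {1}[bracket _ _]ex' (linear_combination _ _ (Phi_r _)).
rewrite [X in _ + X]exchange_big -big_split big1 //= => j _.
rewrite -big_split big1 //= => i _; rewrite -scalerDl.
have -> : b (bracket x (e' i)) (e j) = - b (bracket x (e j)) (e' i).
  by rewrite [in RHS]bracketC bC -bI invariant_formNl // opprK.
by rewrite addrN scale0r.
Qed.

End CasimirTensor.

(** The matrices act on row vectors from the right, whence the order of the
   products. *)
Definition is_rep n (rho : g -> 'M[C]_n) : Prop :=
  linear rho /\
  forall x y, rho (bracket x y) = rho y *m rho x - rho x *m rho y.

Definition trace_form n (rho : g -> 'M[C]_n) (x y : g) : C :=
  \tr (rho x *m rho y).

Lemma trace_form_invariant n (rho : g -> 'M[C]_n) :
  is_rep rho -> invariant_form (trace_form rho).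
Proof.
move=> [rl rb]; rewrite /trace_form; split=> [y c u v|x y|x y z].
- by rewrite rl mulmxDl -scalemxAl linearD linearZ.
- exact: mxtrace_mulC.
- rewrite !rb mulmxBl mulmxBr !linearB /= -[rho y *m rho x *m rho z]mulmxA.
  by rewrite mxtrace_mulC !mulmxA.
Qed.

(** Schur's lemma: b' x y = b (phi x) y for an endomorphism phi commuting with
   the adjoint action, and an eigenspace of phi is an ideal. *)
Lemma invariant_form_proportional (b b' : g -> g -> C) :
  simple_lie g -> invariant_form b -> invariant_form b' ->
  (forall x, (forall y, b x y = 0) -> x = 0) ->
  exists mu : C, forall x y, b' x y = mu * b x y.
Proof.
move=> simp binv b'inv nd; have Ku := gram_unitmx binv nd.
have dim0 : (0 < \dim {:g})%N.
  rewrite lt0n dimv_eq0; case: simp => -[x [y xy]] _.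
  apply: contraNneq xy => g0; have := memvf (bracket x y).
  by rewrite g0 memv0.
have [mu /eigenvalueP[v vE v0]] :=
  eigenvalue_exists (gram b' *m invmx (gram b)) dim0.
exists mu => x.
apply: (@simple_ideal [set x | forall y, b' x y = mu * b x y]) => //.
- split=> [y|c u w bu bw y]; first by rewrite !invariant_form0 ?mulr0.
  by rewrite !invariant_form_linear // bu bw mulrDr mulrCA.
- move=> u w bw y; rewrite bracketC.
  have -> : - bracket w u = bracket w (- u) by rewrite linearN.
  by case: binv b'inv => _ _ -> [_ _ ->]; rewrite bw.
- exists (\sum_i v 0 i *: tnth (vbasis {:g}) i).
    by apply: contraNneq v0 => /vbasis_sum_eq0 ->.
  move=> y; have [c ->] := vbasis_sum y.
  case: (binv) (b'inv) => _ bC _ [_ b'C _]; rewrite bC b'C.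
  rewrite !invariant_form_suml // mulr_sumr; apply: eq_bigr => j _.
  rewrite mulrCA; congr (_ * _); rewrite bC b'C -!gramE //.
  have -> : v *m gram b' = mu *: (v *m gram b).
    by rewrite scalemxAl -vE mulmxA mulmxKV.
  by rewrite mxE.
Qed.

Definition coords (x : g) : 'rV[C]_(\dim {:g}) :=
  \row_i coord (vbasis {:g}) i x.

Definition adjoint_mx (x : g) : 'M[C]_(\dim {:g}) :=
  \matrix_i coords (bracket x (tnth (vbasis {:g}) i)).

Lemma coords_linear : linear coords.
Proof. by move=> c x y; apply/rowP => i; rewrite !mxE linearP. Qed.

Lemma coords_inj : injective coords.
Proof.
move=> x y xy; rewrite (coord_vbasis (memvf x)) (coord_vbasis (memvf y)).
apply: eq_bigr => i _; congr (_ *: _).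
by have := congr1 (fun v : 'rV_(_) => v 0 i) xy; rewrite !mxE.
Qed.

Lemma coords_adjoint x z : coords z *m adjoint_mx x = coords (bracket x z).
Proof.
have [c ->] := vbasis_sum z.
rewrite [bracket x _](linear_combination _ _ (bracket_linear_r x)).
rewrite !(linear_combination _ _ coords_linear) mulmx_suml.
apply: eq_bigr => i _; rewrite -scalemxAl; congr (_ *: _).
have -> : coords (tnth (vbasis {:g}) i) = delta_mx 0 i.
  apply/rowP => j; rewrite !mxE (tnth_nth 0) coord_free ?eqxx //.
    by rewrite eq_sym.
  exact: basis_free (vbasisP _).
by rewrite -rowE rowK.
Qed.

Lemma adjoint_rep : is_rep adjoint_mx.
Proof.
split=> [c x y|x y]; apply/row_matrixP => i.
  rewrite linearP /= !rowK -coords_linear; congr coords.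
  by have := bracket_linear_l (tnth (vbasis {:g}) i) c x y.
rewrite linearB /= !row_mul !rowK !coords_adjoint jacobi.
set u := bracket (bracket x y) _; set w := bracket y _.
by have := coords_linear 1 u w; rewrite !scale1r => ->; rewrite addrK.
Qed.

Lemma killing_trace_form : @killing C g = trace_form adjoint_mx.
Proof.
apply/funext => x; apply/funext => y; rewrite /trace_form mxtrace_mulC.
apply: eq_bigr => i _; set b := tnth _ _.
transitivity (coords (bracket x (bracket y b)) 0 i); first by rewrite [RHS]mxE.
rewrite -coords_adjoint [LHS]mxE [RHS]mxE; apply: eq_bigr => j _.
by rewrite [adjoint_mx y i j]mxE.
Qed.

Definition sl2_triple (e f t : g) : Prop :=
  [/\ e != 0, bracket t e = 2 *: e, bracket t f = - 2 *: f & bracket e f = t].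

Lemma sl2_triple_adjoint e f t : sl2_triple e f t ->
  sl2_action (bracket e) (bracket f) (bracket t).
Proof.
move=> [_ te tf ef].
have Zl (c : C) (x y : g) : bracket (c *: x) y = c *: bracket x y.
  exact: (linear_funZ _ _ (bracket_linear_l y)).
by split=> w /=; rewrite jacobi ?te ?tf ?ef ?Zl ?scaleNr addrC.
Qed.

Lemma finite_spectrum_adjoint x : finite_spectrum (bracket x : g -> g).
Proof.
have [d fs] := finite_spectrum_mx (adjoint_mx x); exists d => rs urs rsx.
apply: fs => // a /rsx[v v0 xv]; exists (coords v).
  apply: contraNneq v0 => v0; apply/eqP/coords_inj.
  by rewrite v0 (linear_fun0 coords_linear).
by rewrite coords_adjoint xv (linear_funZ _ _ coords_linear).
Qed.

Section Representation.
Variables (n : nat) (rho : g -> 'M[C]_n) (e f t : g).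
Hypotheses (rep : is_rep rho) (sl2 : sl2_triple e f t).

Lemma repZ c x : rho (c *: x) = c *: rho x.
Proof. by case: rep => rl _; exact: linear_funZ. Qed.

Lemma sl2_triple_rep :
  sl2_action (mulmxr (rho e) : {linear 'rV_n -> 'rV_n}) (mulmxr (rho f))
    (mulmxr (rho t)).
Proof.
case: (rep) (sl2) => _ rb [_ te tf ef].
have brk (w : 'rV_n) x y :
    w *m rho y *m rho x = w *m rho x *m rho y + w *m rho (bracket x y).
  by rewrite rb mulmxBr !mulmxA addrC subrK.
split=> w /=; rewrite brk.
- by rewrite te repZ -scalemxAr.
- by rewrite tf repZ -scalemxAr scaleNr.
- by rewrite ef.
Qed.

Lemma sl2_triple_eigenvalue a :
  eigenvalue (rho t) a -> exists z : int, a = z%:~R.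
Proof.
move=> /eigenvalueP[v vt v0].
exact: (sl2_integral_weight sl2_triple_rep (finite_spectrum_mx _) v0 vt).
Qed.

Lemma trace_form_sl2_ge0 : 0 <= trace_form rho t t /\
  (trace_form rho t t = 0 -> forall a, eigenvalue (rho t) a -> a = 0).
Proof.
have [d [dt _ tr]] := mxtrace_eigenvalues (rho t); rewrite /trace_form tr.
have d2 i : 0 <= d i ^+ 2.
  have [|z ->] := @sl2_triple_eigenvalue (d i); first by apply/dt; exists i.
  by rewrite -rmorphXn /= ler0z sqr_ge0.
split=> [|tr0 a /dt[i ->]]; first exact: sumr_ge0.
suff : d i ^+ 2 == 0 by rewrite expf_eq0 => /eqP.
move/eqP: tr0; rewrite psumr_eq0 // => /allP/(_ i).
by rewrite mem_index_enum => /(_ isT).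
Qed.

(** If 0 is the only weight of a representation, then the raising operator
   maps the generalized weight space 0, which is everything, to the one of
   weight 2, so it vanishes; the kernel of the representation is an ideal. *)
Lemma rep_trivial : simple_lie g ->
  (forall a, eigenvalue (rho t) a -> a = 0) -> forall x, rho x = 0.
Proof.
move=> simp t0; case: (rep) (sl2) => rl rb [e0 te _ _].
have comm : (rho e) *m (rho t - 2%:M) = rho t *m rho e.
  have := rb t e; rewrite te repZ => E.
  by rewrite mulmxBr mul_mx_scalar E opprB addrC subrK.
have unit2 : rho t - 2%:M \in unitmx.
  rewrite -row_free_unit; apply: inj_row_free => v.
  rewrite mulmxBr mul_mx_scalar => /eqP; rewrite subr_eq0 => /eqP vt.
  apply/eqP; apply: contraT => v0.
  have : (2 : C) = 0 by apply: t0; apply/eigenvalueP; exists v.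
  by move/eqP; rewrite pnatr_eq0.
have iterE m : rho e *m iter m (mulmx (rho t - 2%:M)) 1%:M =
    iter m (mulmx (rho t)) 1%:M *m rho e.
  elim: m => [|m IHm]; first by rewrite mul1mx mulmx1.
  by rewrite !iterS mulmxA comm -mulmxA IHm mulmxA.
have re0 : rho e = 0.
  have := iterE n; rewrite (nilpotent_of_spectrum t0) mul0mx => E.
  have U m : iter m (mulmx (rho t - 2%:M)) 1%:M \in unitmx.
    by elim: m => [|m IHm]; rewrite ?unitmx1 // iterS unitmx_mul unit2.
  by rewrite -[rho e](mulmxK (U n)) E mul0mx.
apply: (@simple_ideal [set x | rho x = 0]) => //; last by exists e.
  split=> [|c x y /= rx ry]; last by rewrite rl rx ry scaler0 addr0.
  exact: (linear_fun0 rl).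
by move=> x y /= ry; rewrite rb ry mul0mx mulmx0 subr0.
Qed.

End Representation.

Lemma killing_invariant : invariant_form (@killing C g).
Proof. rewrite killing_trace_form; exact: trace_form_invariant adjoint_rep. Qed.

(** The square of the eigenvalue 2 contributes to the trace of (ad t)^2. *)
Lemma killing_sl2_gt0 e f t : sl2_triple e f t -> 0 < killing t t.
Proof.
move=> sl2; have [ge0 eq0] := trace_form_sl2_ge0 adjoint_rep sl2.
rewrite killing_trace_form lt_def ge0 andbT; apply/eqP => /eq0 tr0.
case: sl2 => e0 te _ _.
have : (2 : C) = 0.
  apply: tr0; apply/eigenvalueP; exists (coords e).
    by rewrite coords_adjoint te (linear_funZ _ _ coords_linear).
  apply: contraNneq e0 => e0; apply/eqP/coords_inj.
  by rewrite e0 (linear_fun0 coords_linear).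
by move/eqP; rewrite pnatr_eq0.
Qed.

Lemma killing_nondegenerate e f t : simple_lie g -> sl2_triple e f t ->
  forall x : g, (forall y, killing x y = 0) -> x = 0.
Proof.
move=> simp sl2; apply: invariant_form_nondegenerate => //.
  exact: killing_invariant.
by exists t, t; rewrite gt_eqF // (killing_sl2_gt0 sl2).
Qed.

(** By invariance, the Killing form pairs the left-hand side with y to the trace
   of ad x \o ad y, which is the Killing form of x and y. *)
Lemma casimir_adjoint (u' : 'I_(\dim {:g}) -> g) x :
  casimir_tensor (@killing C g) (tnth (vbasis {:g})) u' ->
  (forall x : g, (forall y, killing x y = 0) -> x = 0) ->
  \sum_j bracket (bracket x (tnth (vbasis {:g}) j)) (u' j) = x.
Proof.
move=> ct nd; case: (ct) => ex _ _; set u := tnth _.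
have kinv := killing_invariant; case: (kinv) => kl kC kI.
apply/eqP; rewrite -subr_eq0; apply/eqP/nd => y.
rewrite addrC -scaleN1r invariant_form_linear // mulN1r; apply/eqP.
rewrite addrC subr_eq0; apply/eqP.
rewrite invariant_form_sum //.
have tr z w : killing z w = \sum_j killing (bracket z (bracket w (u j))) (u' j).
  apply: eq_bigr => j _; rewrite -/(u j); set v := bracket z _.
  rewrite {1}(ex v) (eq_bigr (fun i => killing v (u' i) *: (vbasis {:g})`_i)).
    by rewrite coord_sum_free // (basis_free (vbasisP _)).
  by move=> i _; rewrite (tnth_nth 0).
rewrite tr.
transitivity (\sum_j - killing (bracket y (u' j)) (bracket x (u j))).
  apply: eq_bigr => j _; rewrite kI (bracketC (u' j)).
  by rewrite kC (invariant_formNl _ _ kinv).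
have := @casimir_tensorC _ _ _ _ kinv ct C^o
   (fun v w => - killing (bracket y v) (bracket x w)) => ->.
- apply: eq_bigr => j _; rewrite -(kI _ x) -(invariant_formNl _ _ kinv).
  by congr killing; rewrite [RHS]bracketC.
- move=> w c v z; rewrite /= linearP kl opprD.
  by rewrite /GRing.scale /= mulrN.
- move=> w c v z; rewrite /= linearP (invariant_form_linear_r _ kinv) opprD.
  by rewrite /GRing.scale /= mulrN.
Qed.

(** The trace form of rho is a multiple mu of the Killing form, and mu >= 0
   since both forms are nonnegative on t. Taking traces of the Casimir
   operator gives c dim rho = mu dim g. If c = 0, then mu = 0, so that all
   weights of t are 0 and rep_trivial applies. *)
Lemma casimir_ge0 n (rho : g -> 'M[C]_n) e f t (J : finType) (u u' : J -> g) c :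
  simple_lie g -> sl2_triple e f t -> is_rep rho -> (0 < n)%N ->
  casimir_tensor (@killing C g) u u' ->
  (forall a, eigenvalue (\sum_j rho (u j) *m rho (u' j)) a -> a = c) ->
  0 <= c /\ (c = 0 -> forall x, rho x = 0).
Proof.
move=> simp sl2 rep n0 [ex _ dual] Oc.
have [mu rmu] := invariant_form_proportional simp killing_invariant
  (trace_form_invariant rep) (killing_nondegenerate simp sl2).
have ktt := killing_sl2_gt0 sl2; have [r0 req0] := trace_form_sl2_ge0 rep sl2.
have mu0 : 0 <= mu by rewrite -(pmulr_lge0 mu ktt) -rmu.
have trO : n%:R * c = mu * #|J|%:R.
  set O := \sum_j _ in Oc; transitivity (\tr O).
    have [d [dO -> _]] := mxtrace_eigenvalues O.
    rewrite (eq_bigr (fun=> c)) => [|i _]; last by apply/Oc/dO; exists i.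
    by rewrite sumr_const card_ord mulr_natl.
  rewrite /O linear_sum /= (eq_bigr (fun=> mu)) => [|j _].
    by rewrite sumr_const mulr_natr.
  by have := rmu (u j) (u' j); rewrite dual eqxx mulr1.
have nC : 0 < n%:R :> C by rewrite ltr0n.
split=> [|c0]; first by rewrite -(pmulr_rge0 _ nC) trO mulr_ge0 // ler0n.
apply: (rep_trivial rep sl2 simp); apply: req0; rewrite rmu.
have J0 : #|J|%:R != 0 :> C.
  rewrite pnatr_eq0; apply/eqP => J0; case: (sl2) => /eqP e0 _ _ _.
  by apply: e0; rewrite (ex e) big_pred0 // => j; have := fintype0 j J0.
move/eqP: trO; rewrite c0 mulr0 eq_sym mulf_eq0 (negPf J0) orbF => /eqP ->.
by rewrite mul0r.
Qed.

End Forms.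

(** * Positivity of the dual Coxeter number *)

Section DualCoxeter.
Variables (C : numClosedFieldType) (g : lieAlgebra C) (h : {vspace g}).
Implicit Types (a b theta : weightType h) (t : subvs_of h).

Lemma coroot_sl2_triple theta t : is_coroot theta t ->
  exists e f : g, sl2_triple e f (vsval t) /\ root_space theta e.
Proof.
move=> [[e [f [te tf tE]]] tt]; exists e, f; split=> //; split=> //.
- apply/eqP => e0.
  have t0 : t = 0.
    by apply: val_inj; rewrite /= tE e0 bracketC linear0 oppr0.
  by move/eqP: tt; rewrite t0 linear0 eq_sym pnatr_eq0.
- by rewrite te tt.
- by rewrite tf opp_lfunE tt.
Qed.

Lemma root_space_bracket a b (x y : g) :
  root_space a x -> root_space b y -> root_space (a + b) (bracket x y).
Proof.
move=> ax bY s; rewrite jacobi ax bY add_lfunE linearZ /=.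
rewrite bracketC linearZ /= -scalerN -bracketC -scalerDl.
by [].
Qed.

Section PositiveSystem.
Variables (pos : seq (weightType h)) (theta : weightType h) (t : subvs_of h).
Hypotheses (pos_system : positive_system pos) (theta_pos : theta \in pos).
Hypothesis theta_coroot : is_coroot theta t.

Lemma root_integral a : a \in pos -> exists z : int, (a t : C) = z%:~R.
Proof.
case: pos_system => _ pr _ _ /pr[_ [z z0 az]].
have [e [f [sl2 _]]] := coroot_sl2_triple theta_coroot.
exact: (sl2_integral_weight (sl2_triple_adjoint sl2)
  (finite_spectrum_adjoint _) z0 (az t)).
Qed.

(** The theta-string from a positive root a with a(t) < 0 up to its
   reflection is unbroken; it stays positive because it never meets 0: otherwise
   -theta would be positive. *)
Lemma positive_string a (m j : nat) : a \in pos -> (a t : C) = - m%:R ->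
  (j <= m)%N -> a + theta *+ j \in pos.
Proof.
case: (pos_system) => _ pr pN pD apos am.
have [e [f [sl2 te]]] := coroot_sl2_triple theta_coroot.
have [_ [z z0 az]] := pr a apos.
have tz : bracket (vsval t) z = - m%:R *: z by rewrite az am.
have zj i : root_space (a + theta *+ i) (iter i (bracket e) z).
  elim: i => [|i IHi]; first by rewrite addr0.
  by rewrite iterS mulrS addrCA; exact: root_space_bracket.
elim: j => [|j IHj] jm; first by rewrite addr0.
have {}IHj := IHj (ltnW jm).
have -> : a + theta *+ j.+1 = (a + theta *+ j) + theta by rewrite mulrSr addrA.
apply: pD => //; split; last first.
  exists (iter j.+1 (bracket e) z); last by rewrite -addrA -mulrSr.
  exact: (sl2_reflect (sl2_triple_adjoint sl2) (finite_spectrum_adjoint _) tz z0 jm).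
apply/negP => /eqP/(canRL (addrK _)); rewrite sub0r => E.
have := pN theta (pr _ theta_pos); rewrite theta_pos.
by rewrite -E IHj.
Qed.

Definition reflection a : weightType h := a - (a t : C) *: theta.

Lemma reflection_coroot a : (reflection a t : C) = - (a t : C).
Proof.
case: theta_coroot => _ tt; rewrite /reflection add_lfunE opp_lfunE scale_lfunE tt.
rewrite /GRing.scale /=; ring.
Qed.

Lemma reflectionK : involutive reflection.
Proof.
move=> a; rewrite {1}/reflection reflection_coroot /reflection scaleNr opprK.
by rewrite subrK.
Qed.

(** The reflection in theta pairs off each positive root that is negative on
   the coroot t with one that is positive on t, and theta itself, which
   contributes 2, is left over. *)
Lemma sum_pos_ge2 : 2 <= \sum_(a <- pos) (a t : C).
Proof.
case: (pos_system) => upos pr pN pD; case: (theta_coroot) => _ tt.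
pose N := [seq a : weightType h <- pos | (a t : C) < 0].
have Nneg a : a \in N -> a \in pos /\ exists2 m : nat, (0 < m)%N & (a t : C) = - m%:R.
  rewrite mem_filter => /andP[an apos]; split=> //.
  have [[m|m] am] := root_integral apos.
    by move: an; rewrite am ltrz0.
  by exists m.+1 => //; rewrite am NegzE mulrNz -pmulrn.
have NP a : a \in N -> reflection a \in pos /\ 0 < (reflection a t : C).
  move=> /Nneg[apos [m m0 am]]; rewrite reflection_coroot am opprK ltr0n; split=> //.
  rewrite /reflection am scaleNr opprK scaler_nat.
  exact: positive_string am (leqnn m).
have thetaN : theta \notin map reflection N.
  apply/mapP => -[a /Nneg[apos _] E]; have := pN theta (pr _ theta_pos).
  have -> : - theta = a.
    have := reflectionK a; rewrite -E => <-; rewrite /reflection tt scaler_nat mulr2n.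
    by rewrite opprD addrA addrN sub0r.
  by rewrite theta_pos apos.
pose s := (theta :: map reflection N) ++ N.
have us : uniq s.
  rewrite cat_uniq cons_uniq thetaN map_inj_uniq; last exact: can_inj reflectionK.
  rewrite filter_uniq // /= andbT; apply/hasPn => a aN.
  have an : (a t : C) < 0 by move: aN; rewrite mem_filter => /andP[].
  rewrite inE negb_or; apply/andP; split.
    by apply: contraTneq an => ->; rewrite tt lt_gtF ?ltr0n.
  apply/mapP => -[b /NP[_ b0] E]; move: an; rewrite E => an.
  by have := lt_trans an b0; rewrite ltxx.
have sub a : a \in s -> a \in pos.
  rewrite mem_cat inE => /orP[/orP[/eqP -> //|/mapP[b /NP[? _] ->] //]|].
  by case/Nneg.
have perm_s : perm_eq [seq a <- pos | a \in s] s.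
  apply: uniq_perm; rewrite ?filter_uniq // => a; rewrite mem_filter.
  by case: (boolP (a \in s)) => //= /sub.
rewrite (bigID (mem s)) /= -big_filter (perm_big _ perm_s) /=.
rewrite big_cat big_cons big_map /= tt.
rewrite (eq_bigr (fun a => - (a t : C))) => [|a _]; last exact: reflection_coroot.
rewrite sumrN subrK lerDl big_seq_cond; apply: sumr_ge0 => a.
rewrite mem_cat negb_or => /andP[apos /andP[_]]; rewrite mem_filter apos andbT.
have [z ->] := root_integral apos.
by rewrite ltrz0 ler0z leNgt.
Qed.

End PositiveSystem.

Lemma dual_coxeter_gt0 (pos : seq (weightType h)) (hv : C) :
  positive_system pos -> is_dual_coxeter pos hv -> 0 < hv.
Proof.
move=> ps [theta [t [[theta_pos _] tt ->]]].
have := sum_pos_ge2 ps theta_pos tt => ge2.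
rewrite /half_sum scale_lfunE sum_lfunE.
apply: ltr_wpDr; last exact: ltr01.
by rewrite mulr_ge0 ?invr_ge0 ?ler0n // (le_trans _ ge2) // ler0n.
Qed.

End DualCoxeter.

(** * Finitely generated subspaces and their coordinates *)

Section Spanned.
Variables (F : fieldType) (W : lmodType F).

Definition spanned (U : set W) : Prop :=
  exists (J : finType) (b : J -> W),
    forall w, U w -> exists c : J -> F, w = \sum_j c j *: b j.

Lemma linear_iter (f : W -> W) n : linear f -> linear (fun v => iter n f v).
Proof. by move=> fl c x y; elim: n => //= n ->; rewrite fl. Qed.

Lemma spanned_sub (U U' : set W) : spanned U' -> U `<=` U' -> spanned U.
Proof. by move=> [J [b bU']] sub; exists J, b => w /sub/bU'. Qed.

(** A subspace of a finitely generated space is the isomorphic image of a space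
   of row vectors, since its preimage in the space of coefficients splits off
   the relations. *)
Lemma spanned_coordinates (U : set W) : submodule U -> spanned U ->
  exists n (u : 'rV[F]_n -> W),
    [/\ linear u, injective u & forall w, U w <-> exists v, u v = w].
Proof.
move=> SU [J [b bU]].
pose phi (c : {ffun J -> F^o}) := \sum_j (c j : F) *: b j.
have phil : linear phi.
  move=> a c d; rewrite /phi scaler_sumr -big_split; apply: eq_bigr => j _ /=.
  by rewrite !ffunE scalerDl scalerA.
have [S SP] : exists S : {vspace {ffun J -> F^o}}, forall c, c \in S <-> U (phi c).
  apply: (@submodule_vspace _ {ffun J -> F^o} [set c | U (phi c)]).
  split=> [|a c d /= Uc Ud]; first by rewrite /= linear_fun0 //; exact: SU.1.
  by rewrite phil; apply: SU.2.
have [K KP] : exists K : {vspace {ffun J -> F^o}}, forall c, c \in K <-> phi c = 0.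
  apply: (@submodule_vspace _ {ffun J -> F^o} [set c | phi c = 0]).
  split=> [|a c d /= c0 d0]; first by rewrite /= linear_fun0.
  by rewrite phil c0 d0 scaler0 addr0.
pose D := (S :\: K)%VS.
pose psi (v : 'rV[F]_(\dim D)) := \sum_i v 0 i *: (vbasis D)`_i.
have psil : linear psi.
  move=> a c d; rewrite /psi scaler_sumr -big_split; apply: eq_bigr => j _ /=.
  by rewrite !mxE scalerDl scalerA.
have psiD v : psi v \in D.
  by apply: memv_suml => i _; rewrite memvZ // vbasis_mem // mem_nth // size_tuple.
have ul : linear (phi \o psi) by move=> a c d; rewrite /= psil phil.
have u0 v : (phi \o psi) v = 0 -> v = 0.
  move=> /KP psiK; have : psi v \in (D :&: K)%VS by rewrite memv_cap psiD.
  rewrite capv_diff memv0 => /eqP psi0.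
  have /freeP fr := basis_free (vbasisP D).
  by apply/rowP => i; rewrite mxE; exact: (fr (fun i => v 0 i)).
exists (\dim D), (phi \o psi); split=> //.
  move=> v w vw; apply/eqP; rewrite -subr_eq0; apply/eqP/u0.
  by rewrite addrC -scaleN1r ul vw scaleN1r addNr.
move=> w; split=> [Uw|[v <-]]; last first.
  by apply/SP; have := psiD v; rewrite /D; apply/subvP/diffvSl.
have [c wc] := bU w Uw; pose s : {ffun J -> F^o} := [ffun j => c j].
have ws : w = phi s by rewrite wc; apply: eq_bigr => j _; rewrite ffunE.
have : s \in S by apply/SP; rewrite -ws.
rewrite -(addv_diff_cap S K) => /memv_addP[d dD [k]].
rewrite memv_cap => /andP[_ /KP k0] sE.
exists (\row_i coord (vbasis D) i d); rewrite ws sE.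
have := phil 1 d k; rewrite !scale1r k0 addr0 => -> /=; congr phi.
by rewrite [RHS](coord_vbasis dD); apply: eq_bigr => i _; rewrite mxE.
Qed.

Lemma coordinates_operator n (u : 'rV[F]_n -> W) (T : W -> W) :
  linear u -> linear T -> (forall v, exists v', T (u v) = u v') ->
  exists M : 'M[F]_n, forall v, T (u v) = u (v *m M).
Proof.
move=> ul Tl st.
have [r rP] := choice (fun i : 'I_n => st (delta_mx 0 i)).
exists (\matrix_i r i) => v.
rewrite {1}(row_sum_delta v) (linear_combination _ _ ul).
rewrite (linear_combination _ _ Tl) mulmx_sum_row (linear_combination _ _ ul).
by apply: eq_bigr => i _; rewrite rP rowK.
Qed.

(** The component of w in the generalized kernel of T is q(T) w / q(0), for q
   the cofactor of the power of X in the characteristic polynomial of T on U;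
   it has the same image as w because p intertwines T with T', which kills the
   image of w. *)
Lemma gen_kernel_lift (W' : lmodType F) (T : W -> W) (T' : W' -> W')
    (p : W -> W') (U : set W) w :
  linear T -> linear T' -> linear p -> (forall v, p (T v) = T' (p v)) ->
  submodule U -> spanned U -> (forall v, U v -> U (T v)) -> U w ->
  T' (p w) = 0 -> exists2 v, p v = p w & exists N, iter N T v = 0.
Proof.
move=> Tl T'l pl pT SU fU UT Uw Tw0.
have [n [r [rl rinj rU]]] := spanned_coordinates SU fU.
have [A TA] : exists A : 'M[F]_n, forall z, T (r z) = r (z *m A).
  apply: coordinates_operator => // z.
  by have /rU[z' <-] : U (T (r z)) by [apply/UT/rU; exists z]; exists z'.
have /rU[z zw] := Uw; case: n r rl rinj rU A TA z zw => [|n] r rl rinj rU A TA z zw.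
  exists w => //; exists 0%N; rewrite /= -zw.
  by rewrite (_ : z = 0) ?linear_fun0 //; apply/rowP; case.
have [m [q]] := multiplicity_XsubC (char_poly A) 0.
rewrite monic_neq0 ?char_poly_monic //= rootE => q0 charA.
exists (q.[0]^-1 *: r (z *m horner_mx A q)).
  have pq (q' : {poly F}) : p (r (z *m horner_mx A q')) = q'.[0] *: p w.
    elim/poly_ind: q' => [|q' k IHq].
      by rewrite rmorph0 mulmx0 (linear_fun0 rl) (linear_fun0 pl) horner0 scale0r.
    rewrite rmorphD rmorphM /= horner_mx_X horner_mx_C mulmxDr mul_mx_scalar.
    rewrite addrC rl -mulmxE mulmxA -TA pl pT IHq zw hornerMXaddC mulr0 add0r.
    by rewrite (linear_funZ _ _ T'l) Tw0 scaler0 addr0.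
  by rewrite (linear_funZ _ _ pl) pq scalerA mulVf // scale1r.
have iterT N y : iter N T (r y) = r (y *m A ^+ N).
  elim: N => [|N /= ->]; first by rewrite mulmx1.
  by rewrite TA -mulmxA mulmxE exprSr.
exists m; rewrite -(linear_funZ _ _ rl) iterT -scalemxAl -mulmxA.
have -> : horner_mx A q *m A ^+ m = 0.
  rewrite -[RHS](Cayley_Hamilton A) charA subr0 rmorphM rmorphXn /=.
  by rewrite horner_mx_X mulmxE.
by rewrite mulmx0 scaler0 linear_fun0.
Qed.

End Spanned.

(** * Modes in a vertex superalgebra *)

HB.instance Definition _ (S : comNzRingType) (V : vertexSuperalgebra S)
    (n : int) (a : V) :=
  GRing.isLinear.Build S V V *:%R (@nprod S V n a) (nprod_linear_r n a).

Section Modes.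
Variables (S : comNzRingType) (V : vertexSuperalgebra S).

Lemma nprodDl n (a b c : V) : (a + b) \circ_n c = a \circ_n c + b \circ_n c.
Proof. by have := nprod_linear_l n c 1 a b; rewrite !scale1r. Qed.

Lemma nprod0l n (c : V) : 0 \circ_n c = 0.
Proof.
by have := nprod_linear_l n c (-1) 0 0; rewrite scaleN1r addr0 oppr0 scaleN1r addNr.
Qed.

Lemma nprodZl n k (a c : V) : (k *: a) \circ_n c = k *: (a \circ_n c).
Proof. by have := nprod_linear_l n c k a 0; rewrite nprod0l !addr0. Qed.

Lemma nprod_suml n (J : Type) (r : seq J) (P : pred J) (a : J -> V) c :
  (\sum_(j <- r | P j) a j) \circ_n c = \sum_(j <- r | P j) (a j \circ_n c).
Proof.
elim/big_rec2: _ => [|j x y _ <-]; first exact: nprod0l.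
by rewrite nprodDl.
Qed.

(** The commutator formula: the case n = 0 of the Borcherds identity. *)
Lemma commutator (m : nat) (l : int) q (a b c : V) :
  parity false a -> parity q b ->
  a \circ_m%:Z (b \circ_l c) = b \circ_l (a \circ_m%:Z c) +
    \sum_(i < m.+1) ((a \circ_i%:Z b) \circ_(m%:Z + l - i%:Z) c) *+ 'C(m, i).
Proof.
move=> pa pb; have [N0] := borcherds l m%:Z 0 c pa pb.
move/(_ (maxn N0 m.+1) (leq_maxl _ _)); set N := maxn _ _ => bor.
have mN : (m.+1 <= N)%N := leq_maxr _ _.
rewrite [\sum_(i < m.+1) _](big_ord_widen _ (fun i : nat =>
  ((a \circ_i%:Z b) \circ_(m%:Z + l - i%:Z) c) *+ 'C(m, i)) mN).
rewrite big_mkcond /=.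
have {}bor : \sum_(i < N)
    (if (i < m.+1)%N then ((a \circ_i%:Z b) \circ_(m%:Z + l - i%:Z) c) *+ 'C(m, i)
     else 0) = a \circ_m%:Z (b \circ_l c) - b \circ_l (a \circ_m%:Z c).
  transitivity (\sum_(i < N) ((a \circ_i%:Z b) \circ_(m%:Z + l - i%:Z) c) *~ binz m i).
    apply: eq_bigr => i _; rewrite /binz -pmulrn ltnS; case: leqP => // mi.
    by rewrite bin_small.
  have N0' : (0 < N)%N by apply: leq_trans mN.
  under eq_bigr do rewrite -[X in _ \circ_X b]add0r.
  rewrite bor (bigD1 (Ordinal N0')) //= big1 => [|i].
    by rewrite !addr0 !add0r expr0 scale1r.
  by rewrite -val_eqE /= bin0n => /negPf ->; rewrite mulr0.
by rewrite bor addrC subrK.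
Qed.

(** The Borcherds identity with m = 0 expresses the left-hand side by modes of
   index at least 0 of a and b, applied to c. *)
Lemma nprod_commutant (n : int) (l : nat) q (a b c : V) :
  parity false a -> parity q b ->
  (forall i : nat, a \circ_i%:Z c = 0) -> (forall i : nat, b \circ_i%:Z c = 0) ->
  (a \circ_n b) \circ_l%:Z c = 0.
Proof.
move=> pa pb ac bc; have [N0] := borcherds l%:Z 0 n c pa pb.
move/(_ N0.+1 (leqnSn _)); rewrite big_ord_recl /=.
rewrite addr0 add0r subr0 big1 => [|i _]; last by rewrite bin0n mulr0z.
rewrite addr0 bin0 mulr1z => ->; rewrite big1 // => i _.
by rewrite -PoszD bc add0r ac !linear0 addr0 mul0rz.
Qed.

(** The Borcherds identity with l = 1, m = 0 and n = -1: in the normally ordered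
   sum on the right, only the product of the two zero modes survives. *)
Lemma normal_product_mode q (a b c : V) :
  parity false a -> parity q b ->
  (forall i : nat, a \circ_(i.+1)%:Z c = 0) ->
  (forall i : nat, b \circ_(i.+1)%:Z c = 0) ->
  (a \circ_(-1) b) \circ_1 c = b \circ_0 (a \circ_0 c).
Proof.
move=> pa pb ac bc; have [N0] := borcherds 1 0 (-1) c pa pb.
move/(_ N0.+1 (leqnSn _)); rewrite big_ord_recl /=.
rewrite addr0 add0r subr0 big1 => [|i _]; last by rewrite bin0n mulr0z.
rewrite addr0 bin0 mulr1z => ->; rewrite big_ord_recl big1 ?addr0 => [|i _].
  by rewrite (bc 0%N) linear0 /= expr1 scaleN1r opprK add0r.
rewrite /= /bump /= add1n -PoszD add1n bc add0r ac !linear0.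
by rewrite addr0 mul0rz.
Qed.

End Modes.

(** * Vectors of bounded weight *)

Section BoundedWeight.
Variables (F : fieldType) (W : vertexSuperalgebra F).

Definition weight_below (M : nat) : set W :=
  [set w | exists2 d : nat -> W, forall m, weight m (d m) & w = \sum_(m < M) d m].

Lemma weight_submodule m : submodule (@weight _ W m).
Proof. by have [subm _ _] := weight_sum W; apply: subm. Qed.

Lemma weight_below_submodule M : submodule (weight_below M).
Proof.
split=> [|k v w [d dw ->] [d' dw' ->]].
  exists (fun=> 0) => [m|]; last by rewrite big1.
  by have [] := weight_submodule m.
exists (fun m => k *: d m + d' m) => [m|].
  by have [_] := weight_submodule m; apply.
by rewrite scaler_sumr -big_split.
Qed.

Lemma weight_below_weight m M w : (m < M)%N -> weight m w -> weight_below M w.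
Proof.
move=> mM wm; exists (fun i => if i == m then w else 0) => [i|].
  by case: eqP => [->|_] //; have [] := weight_submodule i.
rewrite (bigD1 (Ordinal mM)) //= eqxx big1 ?addr0 // => i.
by rewrite -val_eqE /= => /negPf ->.
Qed.

Lemma weight_below_exists w : exists M, weight_below M w.
Proof.
have [_ /(_ w) [s [d [_ dw ->]]] _] := weight_sum W.
exists (\max_(i <- s) i)%N.+1; rewrite [X in weight_below _ X]big_seq.
apply: submodule_sum => [|i si].
  exact: weight_below_submodule.
apply: (@weight_below_weight i) => //; rewrite ltnS.
exact: (@leq_bigmax_seq _ s xpredT id).
Qed.

Lemma weight_below_nprod (b : nat) (n r M : nat) (v w : W) :
  weight b v -> n.+1 = (b + r)%N -> weight_below M w ->
  weight_below (M - r) (v \circ_n%:Z w).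
Proof.
move=> bv nb [d dw ->]; rewrite linear_sum /=.
apply: submodule_sum => [|m _]; first exact: weight_below_submodule.
have := nprod_weight n%:Z bv (dw m).
have [rm|mr] := leqP r m.
  have -> : b%:Z + (m : nat)%:Z - n%:Z - 1 = (m - r)%N%:Z by lia.
  by apply: weight_below_weight; have := ltn_ord m; lia.
have -> : b%:Z + (m : nat)%:Z - n%:Z - 1 = Negz (r - m).-1 by rewrite NegzE; lia.
by move=> ->; have [] := weight_below_submodule (M - r).
Qed.

Lemma weight_below_spanned M :
  (forall m, fin_dim (@weight _ W m)) -> spanned (weight_below M).
Proof.
move=> fin.
elim: M => [|M [J [b bM]]].
  exists 'I_0, (fun=> 0) => w [d _ ->]; exists (fun=> 0).
  by rewrite !big_ord0.
have [n [b' [_ bn]]] := fin M.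
exists (J + 'I_n)%type,
  (fun j => match j with inl j => b j | inr i => b' i end).
move=> w [d dw ->]; rewrite big_ord_recr /=.
have [|q ->] := bM (\sum_(i < M) d i); first by exists d.
have [q' [-> _]] := bn _ (dw M).
exists (fun j => match j with inl j => q j | inr i => q' i end).
by rewrite big_sumType.
Qed.

End BoundedWeight.

(** * The Sugawara operator *)

Section Currents.
Variables (C : numClosedFieldType) (g : lieAlgebra C).

(** The relations of V^k(g), with c = k / (2 hv) since the Killing form is
   2 hv times the normalized form. *)
Definition affine_currents (W : vertexSuperalgebra C) (c : C) (x : g -> W) : Prop :=
  [/\ linear x,
      forall u, parity false (x u) /\ weight 1 (x u),
      forall u v, x u \circ_0 x v = x (bracket u v) /\
        x u \circ_1 x v = (c * killing u v) *: vac W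
    & forall u v (n : nat), (2 <= n)%N -> x u \circ_n x v = 0].

Variables (W : vertexSuperalgebra C) (c : C) (x : g -> W).
Hypothesis cur : affine_currents c x.

Lemma current_mode (m : nat) (l : int) u v (w : W) :
  x u \circ_m%:Z (x v \circ_l w) =
  x v \circ_l (x u \circ_m%:Z w) + x (bracket u v) \circ_(m%:Z + l) w +
  ((c * killing u v) *: (vac W \circ_(m%:Z + l - 1) w)) *+ m.
Proof.
case: cur => xl xp ope ope2; rewrite (commutator _ _ _ (xp u).1 (xp v).1) -addrA.
congr (_ + _); rewrite big_ord_recl bin0 mulr1n; congr (_ + _).
  by rewrite (ope u v).1 addr0.
case: m => [|m]; first by rewrite big_ord0 mulr0n.
rewrite big_ord_recl big1 ?addr0 => [|i _].
  by rewrite /= (ope u v).2 nprodZl bin1.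
by rewrite ope2 ?nprod0l ?mul0rn // /bump.
Qed.

Lemma current_zero_mode (l : int) u v (w : W) :
  x u \circ_0 (x v \circ_l w) =
  x v \circ_l (x u \circ_0 w) + x (bracket u v) \circ_l w.
Proof. by have := current_mode 0 l u v w; rewrite mulr0n addr0 add0r. Qed.

Variables (u' : 'I_(\dim {:g}) -> g).
Local Notation u := (tnth (vbasis {:g})).
Hypothesis ct : casimir_tensor (@killing C g) u u'.
Hypothesis nd : forall y : g, (forall z, killing y z = 0) -> y = 0.

(** Dual bases for the Killing form are used, and no normalization: the Sugawara
   vector is this one divided by 1 + 2 c. *)
Definition sugawara_vector : W := \sum_j x (u j) \circ_(-1) x (u' j).

Local Notation L := sugawara_vector.

Lemma sugawara_vector_even : parity false L.
Proof.
case: cur => _ xp _ _; apply: submodule_sum => [|j _].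
  by have [subm _ _] := parity_sum W; apply: subm.
exact: (nprod_parity _ (xp _).1 (xp _).1).
Qed.

Lemma sugawara_vector_weight : weight 2 L.
Proof.
case: cur => _ xp _ _; apply: submodule_sum => [|j _].
  by have [subm _ _] := weight_sum W; apply: subm.
exact: (nprod_weight (-1) (xp (u j)).2 (xp (u' j)).2).
Qed.

Lemma current_suml (J : finType) (d : J -> C) (v : J -> g) :
  x (\sum_j d j *: v j) = \sum_j d j *: x (v j).
Proof. by case: cur => xl _ _ _; exact: linear_combination. Qed.

(** Invariance of the Casimir tensor kills the 0-th product, its symmetry the
   second one. The first one collects c kappa(X,e) e' + c kappa(X,e') e, each
   summing to c X, and the Casimir operator of g applied to X. *)
Lemma current_sugawara (n : nat) v :
  x v \circ_n%:Z L = if n == 1%N then (1 + 2 * c) *: x v else 0.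
Proof.
case: (cur) (ct) => xl xp ope ope2 [ex ex' _].
rewrite /L linear_sum /=.
case: n => [|[|[|n]]].
- rewrite (eq_bigr (fun j => x (bracket v (u j)) \circ_(-1) x (u' j) +
      x (u j) \circ_(-1) x (bracket v (u' j)))) => [|j _]; last first.
    by rewrite current_zero_mode (ope v _).1 addrC.
  apply: (casimir_tensor_invariant (killing_invariant _) ct
    (Phi := fun y z => x y \circ_(-1) x z)) => y a z w /=.
    by rewrite xl nprodDl nprodZl.
  by rewrite xl linearP.
- rewrite (eq_bigr (fun j => c *: (killing v (u' j) *: x (u j)) +
      x (bracket (bracket v (u j)) (u' j)) +
      c *: (killing v (u j) *: x (u' j)))) => [|j _]; last first.
    rewrite current_mode (ope v _).2 linearZ /= nprod_vac mulr1n addrN (ope _ _).1.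
    by rewrite sub0r vac_nprod !scalerA.
  rewrite !big_split /= -!scaler_sumr -!current_suml -ex -ex'.
  rewrite -(linear_fun_sum _ _ _ xl) casimir_adjoint // addrC addrA -scalerDl.
  by rewrite -[X in _ + X]scale1r -scalerDl; congr (_ *: _); ring.
- rewrite (eq_bigr (fun j => (c * killing v (bracket (u j) (u' j))) *: vac W))
    => [|j _]; last first.
    rewrite current_mode ope2 // linear0 add0r vac_nprod /= scaler0 mul0rn addr0.
    rewrite (ope _ _).2; case: (killing_invariant g) => _ _ kI.
    by rewrite kI.
  rewrite -scaler_suml -mulr_sumr.
  have kinv := killing_invariant g; have kl := invariant_form_linear_r v kinv.
  have := @casimir_tensorC _ _ _ _ _ _ kinv ct C^o
    (fun y z => killing v (bracket y z)) => sym.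
  have {}sym : \sum_j killing v (bracket (u' j) (u j)) =
               \sum_j killing v (bracket (u j) (u' j)).
    apply: sym => y a z w /=.
      by rewrite -kl !(bracketC _ y) scalerN -opprD -linearP.
    by rewrite linearP kl.
  have : \sum_j killing v (bracket (u j) (u' j)) = 0.
    apply/eqP; rewrite -[_ == 0](mulrn_eq0 _ 2) mulr2n -{1}sym -big_split.
    by rewrite big1 //= => j _; rewrite bracketC invariant_formNr // addNr.
  by move=> ->; rewrite mulr0 scale0r.
- rewrite big1 // => j _; rewrite current_mode ope2 // linear0 add0r.
  rewrite vac_nprod scaler0 mul0rn addr0.
  have -> : n.+3%:Z - 1 = n.+2%:Z by lia.
  exact: ope2.
Qed.

(** Only the first product of the previous lemma contributes to the
   commutator. *)
Lemma current_sugawara_mode (n : nat) v (w : W) :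
  x v \circ_n%:Z (L \circ_1 w) =
  L \circ_1 (x v \circ_n%:Z w) + ((1 + 2 * c) * n%:R) *: (x v \circ_n%:Z w).
Proof.
case: (cur) => _ xp _ _.
rewrite (commutator _ _ _ (xp v).1 sugawara_vector_even); congr (_ + _).
case: n => [|n].
  by rewrite big_ord1 current_sugawara nprod0l mul0rn mulr0 scale0r.
rewrite big_ord_recl current_sugawara nprod0l mul0rn add0r big_ord_recl.
rewrite big1 => [|i _]; last by rewrite current_sugawara nprod0l mul0rn.
rewrite current_sugawara /= bin1 addr0 addrK nprodZl.
by rewrite -scaler_nat scalerA mulrC.
Qed.

Lemma sugawara_singular (w : W) :
  (forall v (n : nat), x v \circ_(n.+1)%:Z w = 0) ->
  L \circ_1 w = \sum_j x (u' j) \circ_0 (x (u j) \circ_0 w).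
Proof.
case: (cur) => _ xp _ _ sing; rewrite /L nprod_suml; apply: eq_bigr => j _.
exact: (normal_product_mode (xp _).1 (xp _).1).
Qed.

(** * Generalized eigenspaces of the Sugawara operator *)

Local Notation T := (fun w : W => L \circ_1 w).
Local Notation shifted a := (fun w : W => T w + a *: w).

Lemma shifted_linear a : linear (shifted a).
Proof.
move=> k v w /=; rewrite linearP !scalerDr !scalerA (mulrC a) -!addrA.
by congr (_ + _); rewrite addrCA.
Qed.

Lemma current_shifted (n N : nat) v a w :
  x v \circ_n%:Z (iter N (shifted a) w) =
  iter N (shifted (a + (1 + 2 * c) * n%:R)) (x v \circ_n%:Z w).
Proof.
elim: N => //= N IHN; rewrite linearD linearZ /= current_sugawara_mode IHN.
by rewrite scalerDl -addrA [_ *: _ + a *: _]addrC.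
Qed.

Definition gen_kernel a : set W := [set w | exists N, iter N (shifted a) w = 0].

Lemma gen_kernel_submodule a : submodule (gen_kernel a).
Proof.
split=> [|k v w [M Mv] [N Nw]]; first by exists 0%N.
have up m n z : iter m (shifted a) z = 0 -> iter (n + m) (shifted a) z = 0.
  by move=> z0; rewrite iterD z0 linear_fun0 //; apply/linear_iter/shifted_linear.
exists (N + M)%N; rewrite linear_iter; last exact: shifted_linear.
by rewrite (up M) // addnC (up N) // scaler0 addr0.
Qed.

Variables (e f t : g).
Hypotheses (simp : simple_lie g) (sl2 : sl2_triple e f t).
Hypothesis level_pos : 0 < 1 + 2 * c.

(** On singular vectors T is the Casimir operator of the action of g by zero
   modes; its eigenvalue - a is nonnegative by casimir_ge0. *)
Lemma singular_gen_kernel (U : set W) a : submodule U -> spanned U ->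
  (forall w, U w -> forall v (n : nat), x v \circ_(n.+1)%:Z w = 0) ->
  (forall w, U w -> forall v, U (x v \circ_0 w)) ->
  (forall w, U w -> gen_kernel a w) -> 0 <= a ->
  (0 < a -> forall w, U w -> w = 0) /\
  (a = 0 -> forall w, U w -> forall v, x v \circ_0 w = 0).
Proof.
move=> SU fU sing stab gen a0; case: (cur) => xl _ _ _.
have [n [r [rl rinj rU]]] := spanned_coordinates SU fU.
have Ur v : U (r v) by apply/rU; exists v.
have matrix v : exists M : 'M[C]_n, forall z, x v \circ_0 r z = r (z *m M).
  apply: (coordinates_operator (T := fun w => x v \circ_0 w)) => //.
    exact: nprod_linear_r.
  by move=> z; have /rU[z' <-] := stab _ (Ur z) v; exists z'.
have [rho rhoP] := choice matrix.
have rhoE M N : (forall z, r (z *m M) = r (z *m N)) -> M = N.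
  by move=> MN; apply/row_matrixP => i; rewrite !rowE; exact/rinj/MN.
have rep : is_rep rho.
  split=> [k v z|v z]; apply: rhoE => y.
    by rewrite -rhoP xl nprodDl nprodZl !rhoP -rl mulmxDr scalemxAr.
  have := current_zero_mode 0 v z (r y); rewrite !rhoP => /esym/(canRL (addKr _)) ->.
  by rewrite -scaleN1r -rl mulmxBr !mulmxA scaleN1r addrC.
have r0 : r 0 = 0 by exact: linear_fun0.
have zero : (forall z, r z = 0) -> forall w, U w -> w = 0.
  by move=> rz w /rU[z <-].
case: (posnP n) => [n0|n0].
  have rz z : r z = 0.
    rewrite -[RHS]r0; congr r; apply/rowP => i.
    by have := ltn_ord i; rewrite [X in (_ < X)%N]n0.
  split=> [_|_ w /(zero rz) -> v]; last by rewrite linear0.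
  exact: zero.
have Om z : T (r z) = r (z *m \sum_j rho (u j) *m rho (u' j)).
  rewrite sugawara_singular; last exact: sing.
  rewrite mulmx_sumr (linear_fun_sum _ _ _ rl); apply: eq_bigr => j _.
  by rewrite !rhoP mulmxA.
have eig b : eigenvalue (\sum_j rho (u j) *m rho (u' j)) b -> b = - a.
  move=> /eigenvalueP[z zb z0]; have [N] := gen _ (Ur z).
  have -> : iter N (shifted a) (r z) = (b + a) ^+ N *: r z.
    elim: N => [|N]; first by rewrite scale1r.
    rewrite iterS => ->; rewrite linearZ /= Om zb.
    by rewrite (linear_funZ _ _ rl) !scalerA -scalerDl exprSr mulrDr [a * _]mulrC.
  move=> /eqP; rewrite scaler_eq0 => /orP[|/eqP rz].
    by rewrite expf_eq0 => /andP[_]; rewrite addr_eq0 => /eqP.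
  by move: z0; rewrite (rinj z 0) ?eqxx // r0.
have [ge0 triv] := casimir_ge0 simp sl2 rep n0 ct eig.
split=> [a_gt0|a_eq0 w /rU[z <-] v].
  by move: ge0; rewrite oppr_ge0 => /(lt_le_trans a_gt0); rewrite ltxx.
by rewrite rhoP triv ?mulmx0 // a_eq0 oppr0.
Qed.

Hypothesis fin : forall m, fin_dim (@weight _ W m).

(** Positive modes lower the weight and raise a, so that the induction on the
   weight shows that they kill w; then w is singular. *)
Lemma sugawara_gen_kernel M w a : weight_below M w -> gen_kernel a w -> 0 <= a ->
  (0 < a -> w = 0) /\
  (a = 0 -> forall v (n : nat), x v \circ_n%:Z w = 0).
Proof.
case: (cur) => _ xp _ _.
elim: M w a => [|M IHM] w a.
  move=> [d _]; rewrite big_ord0 => -> _ _.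
  by split=> // _ v n; rewrite linear0.
pose U : set W := weight_below M.+1 `&` gen_kernel a.
have killed w' : 0 <= a -> U w' -> forall v (n : nat), x v \circ_n.+1%:Z w' = 0.
  move=> a0 [lw [N gw]] v n.
  have s0 : 0 < (1 + 2 * c) * n.+1%:R by rewrite mulr_gt0 // ltr0n.
  have low : weight_below M (x v \circ_n.+1%:Z w').
    have [d dw ->] := weight_below_nprod (r := n.+1) (xp v).2 erefl lw.
    apply: submodule_sum => [|m _]; first exact: weight_below_submodule.
    by apply: weight_below_weight (dw m); have := ltn_ord m; lia.
  have gen : gen_kernel (a + (1 + 2 * c) * n.+1%:R) (x v \circ_n.+1%:Z w').
    by exists N; rewrite -current_shifted gw linear0.
  have [|] := IHM _ _ low gen; first by rewrite addr_ge0 // ltW.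
  by move=> -> //; rewrite ltr_wpDl.
move=> lw gw a0.
have [] := @singular_gen_kernel U a _ _ _ _ _ a0.
- have [low0 lowL] := weight_below_submodule W M.+1.
  have [gen0 genL] := gen_kernel_submodule a.
  by split=> // k v z [? ?] [? ?]; split; [exact: lowL|exact: genL].
- by apply: spanned_sub (@weight_below_spanned _ W M.+1 fin) _ => z [].
- by move=> w'; apply: killed.
- move=> w' [lw' [N gw']] v; split.
    by have := weight_below_nprod (r := 0) (xp v).2 erefl lw'; rewrite subn0.
  by exists N; have := current_shifted 0 N v a w'; rewrite mulr0 addr0 gw' linear0.
- by move=> w' [].
move=> pos zero; split=> [a_gt0|a_eq0 v [|n]]; first exact: pos.
  exact: zero.
exact: killed.
Qed.

End Currents.

(** * The coset of the affine subalgebra *)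

Section Coset.
Variables (C : numClosedFieldType) (g : lieAlgebra C).

(** The vectors whose modes of index at least 0 kill w are closed under products
   by nprod_commutant, and the monomials in the currents span U. *)
Lemma Com_of_currents (U W : vertexSuperalgebra C) (x : g -> U) (f : U -> W)
    (e : (\dim {:g}).-tuple g) w :
  is_vhom id f -> (forall v, parity false (x v)) ->
  freely_generated (fun i => x (tnth e i)) ->
  (forall v (n : nat), f (x v) \circ_n%:Z w = 0) -> Com f w.
Proof.
move=> [fl fvac fprod fpar _] xp [gen _] xw y n.
have sub : submodule [set y | forall n : nat, f y \circ_n%:Z w = 0].
  split=> [m|k y1 y2 /= w1 w2 m]; first by rewrite /= (linear_fun0 fl) nprod0l.
  by rewrite fl nprodDl nprodZl w1 w2 scaler0 addr0.
have [r [d ->]] := gen y; have suml := @submodule_sum _ _ _ _ r xpredT _ sub.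
apply: (suml) n => s _; apply: (submoduleZ _ sub) => n.
elim: (val s) n => [|[m j] s' IHs] n /=; first by rewrite fvac vac_nprod.
have even : parity false
    (foldr (fun y v => x (tnth e y.2) \circ_(- (y.1.+1)%:Z) v) (vac U) s').
  elim: (s') => [|z s'' IHs'']; first exact: vac_even.
  exact: (nprod_parity _ (xp _) IHs'').
rewrite fprod.
by apply: (nprod_commutant _ _ (fpar _ _ (xp _)) (fpar _ _ even)).
Qed.

End Coset.

Theorem theorem8p1 (R : realType)
  (g : lieAlgebra (Cx R)) (g_simple : simple_lie g)
  (h : {vspace g}) (h_cartan : is_cartan h)
  (pos : seq (weightType h)) (pos_system : positive_system pos)
  (hv : Cx R) (hv_dual_coxeter : is_dual_coxeter pos hv)
  (sqrtk : Cx R -> Cx R) (sqrtkP : forall z, sqrtk z ^+ 2 = z)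
  (V : Cx R -> vertexSuperalgebra (Cx R)) (X : forall k, g -> V k)
  (V_affine : forall k, is_universal_affine hv k (X k))
  (A : Cx R -> vertexSuperalgebra (Cx R)) (f : forall k, V k -> A k)
  (K : set (Cx R)) (A_good : good pos hv X sqrtk K f)
  (k : Cx R)
  (A_fin : forall m, fin_dim (@weight _ (A k) m))
  (f_inj : injective (f k))
  (A_not_simple : ~ is_simple (A k))
  (I : set (A k)) (I_max : maximal_graded_ideal I)
  (Ak : vertexSuperalgebra (Cx R)) (p : A k -> Ak) (p_quot : is_quotient I p)
  (J_max : maximal_graded_ideal [set u : V k | p (f k u) = 0])
  (Lk : vertexSuperalgebra (Cx R)) (q : V k -> Lk)
  (q_quot : is_simple_graded_quotient q)
  (i : Lk -> Ak) (i_hom : is_vhom id i) (i_q : forall u, i (q u) = p (f k u))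
  (k_param : ~ K (sqrtk k))
  (k_pos : 0 < k + hv)
  (h_semisimple : forall xi : g, xi \in h ->
     semisimple_op (fun w : A k => f k (X k xi) \circ_0 w)) :
  set_fun (Com (f k)) (Com i) p /\ set_surj (Com (f k)) (Com i) p.
Proof.
have f_hom : is_vhom id (f k) by case: A_good => _ _ /(_ k k_param).
have [p_hom p_surj _] := p_quot; have [pl _ pprod _ _] := p_hom.
have [fl fvac fprod fpar fweight] := f_hom.
split=> [v comv u n|w comw].
  have [I' _ [_ q_surj _]] := q_quot; have [u' <-] := q_surj u.
  by rewrite i_q -pprod comv (linear_fun0 pl).
have hv_gt0 := dual_coxeter_gt0 pos_system hv_dual_coxeter.
have [theta [t0 [_ coroot _]]] := hv_dual_coxeter.
have [e [f' [sl2 _]]] := coroot_sl2_triple coroot.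
have nd := killing_nondegenerate g_simple sl2.
have [u' ct] := casimir_tensor_exists (killing_invariant g) nd.
have [Xl Xp Xope Xope2 Xfree] := V_affine k.
pose c := k / (2 * hv).
have cur : affine_currents c (fun v => f k (X k v)).
  split=> [a y z|v|y z|y z n n2].
  - by rewrite Xl fl.
  - by have [? ?] := Xp v; split; [exact: fpar|exact: fweight].
  - have [X0 X1] := Xope y z; rewrite -!fprod X0 X1 scale1r; split=> //.
    rewrite /normalized_killing /= mulrCA mulrA [_ * k]mulrC -mulrA -/c.
    by rewrite (linear_funZ _ _ fl) fvac; congr (_ *: _); rewrite /c; ring.
  - by rewrite -fprod Xope2 // (linear_fun0 fl).
have level_pos : 0 < 1 + 2 * c.
  rewrite (_ : _ + _ = (k + hv) / hv) ?divr_gt0 //.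
  by rewrite /c; field; rewrite gt_eqF.
have [v0 v0w] := p_surj w; have [M lv0] := weight_below_exists v0.
set L := sugawara_vector (fun v => f k (X k v)) u'.
(* p L comes from the affine vertex algebra inside A_k, with which w commutes. *)
have pL n : p L \circ_n%:Z w = 0.
  have -> : p L = i (q (\sum_j X k (tnth (vbasis {:g}) j) \circ_(-1) X k (u' j))).
    rewrite i_q (linear_fun_sum _ _ _ fl); congr p.
    by apply: eq_bigr => j _; rewrite fprod.
  exact: comw.
have [v vw [N vN]] : exists2 v, p v = p v0 &
    exists N, iter N (fun y => L \circ_1 y) v = 0.
  apply: (@gen_kernel_lift _ _ _ (fun y => L \circ_1 y)
    (fun y => p L \circ_1 y) p (weight_below (W := A k) M) v0) => //.
  - exact: nprod_linear_r.
  - exact: nprod_linear_r.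
  - exact: weight_below_submodule.
  - exact: weight_below_spanned.
  - move=> y lowy.
    have := weight_below_nprod (n := 1) (r := 0)
      (sugawara_vector_weight cur u') erefl lowy.
    by rewrite subn0.
  - by rewrite v0w (pL 1%N).
exists v; last by rewrite vw.
have gv : gen_kernel (fun v => f k (X k v)) u' 0 v.
  exists N; rewrite -[RHS]vN; apply: eq_iter => y.
  by rewrite scale0r addr0.
have [M' lv] := weight_below_exists v.
apply: (Com_of_currents f_hom _ (Xfree _ (vbasisP {:g}))) => [y|y n].
  by have [] := Xp y.
have [_ zero] :=
  sugawara_gen_kernel cur ct nd g_simple sl2 level_pos A_fin lv gv (lexx 0).
exact: zero.
Qed.
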